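(* Let $p$ be a prime, let $\Bbbk$ be a field of characteristic $p$, and take $n=3$. Let $d \ge e > 0$ be integers. Then the character $\kappa(d,e)$ of the $\mathrm{SL}_3$-representation $K(d,e)$ is given, in the ring $A$, by $$\kappa(d,e) = \sum_{i=1}^{\lfloor \log_p e\rfloor} F^i\Big(\mathcal{C}_p\Big(\Big\lfloor \frac{e}{p^i}\Big\rfloor\Big)\Big)^{\vee}\cdot s_{\,p^i+e-d-2,\;\; p^i+p^i\left\lfloor \frac{e}{p^i}\right\rfloor-d-2}.$$
   Context: Let $V=\Bbbk^3$ be the standard representation of $\mathrm{SL}_3$ (over $\Bbbk$). **The representation $K(d,e)$.** Let $X\subset \mathbb{P}^2\times\mathbb{P}^2=\mathbb{P}(V)\times\mathbb{P}(V)^\vee$ be the incidence correspondence, i.e. the hypersurface $z_1w_1+z_2w_2+z_3w_3=0$, with inclusion $\iota$, where the degree-one forms $z_1,z_2,z_3$ on the first factor span $V$. Put $\mathcal{L}_{d,e}=\iota^*\mathcal{O}_{\mathbb{P}^2\times\mathbb{P}^2}(e,-d-2)$ and $K(d,e)=H^{1}(X,\mathcal{L}_{d,e})$, a finite-dimensional $\mathrm{SL}_3$-representation. Equivalently, for $d,e\ge 1$, $K(d,e)$ is the kernel of the natural $\mathrm{SL}_3$-equivariant map $$\mu_{d,e}: D^dV\otimes S^{e-1}V\to D^{d-1}V\otimes V\otimes S^{e-1}V\to D^{d-1}V\otimes S^eV,$$ where $S^mV$ is the symmetric power, $D^mV=(S^m(V^* ))^*$ is the divided power, the first arrow is induced by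 comultiplication $D^dV\to D^{d-1}V\otimes V$ and the second by multiplication $V\otimes S^{e-1}V\to S^eV$. **Characters.** Let $A=\big(\mathbb{Z}[x_1,x_2,x_3]/(x_1x_2x_3-1)\big)^{S_3}$, the character ring of $\mathrm{SL}_3$. The element $\kappa(d,e)\in A$ is the character of $K(d,e)$: the coefficients record the dimensions of the weight spaces under the diagonal torus, normalized so that $V$ has character $x_1+x_2+x_3$. **Operations on $A$.** $\vee$ is the ring involution of $A$ induced by $x_i\mapsto x_i^{-1}$. $F$ is the ring endomorphism induced by $x_i\mapsto x_i^p$, and $F^i$ is its $i$-fold composition (so $F$ and $\vee$ commute). **Schur functions.** For integers $a\ge b\ge 0$, $s_{a,b}\in A$ is the image in $A$ of the Schur polynomial of the partition $(a,b)=(a,b,0)$ in $x_1,x_2,x_3$. If $a\ge b\ge 0$ fails, then $s_{a,b}=0$. **Even-carry polynomials.** A finite multiset $\{a_1,\dots,a_r\}$ of nonnegative integers is *even-carry* (in base $p$) if for every $i\ge 1$ the carry $$c_i=\Big\lfloor\frac{a_1+\cdots+a_r}{p^i}\Big\rfloor-\Big\lfloor\frac{a_1}{p^i}\Big\rfloor-\cdots-\Big\lfloor\frac{a_r}{p^i}\Big\rfloor$$ is an even integer. For an integer $m\ge 0$ the $m$th even-carry polynomial is $$\mathcal{C}_p(m)=\sum_{\substack{a_1,a_2,a_3\ge 0\\ a_1+a_2+a_3+1=m\\ \{a_1,a_2,a_3,1\}\text{ even-carry}}}x_1^{a_1}x_2^{a_2}x_3^{a_3}\in A,$$ the sum being over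 ordered triples $(a_1,a_2,a_3)$ of integers. *)

(* Defs.v *)
From HB Require Import structures.
From mathcomp Require Import all_boot all_order all_algebra.
From mathcomp Require Import generic_quotient ring_quotient.
From mathcomp Require Import mpoly.
From Stdlib Require Import ClassicalDescription.

Set Implicit Arguments.
Unset Strict Implicit.
Unset Printing Implicit Defensive.

Import GRing.Theory.
Local Open Scope ring_scope.

(* The ring Z[x_1,x_2,x_3]/(x_1 x_2 x_3 - 1).  The character ring A of SL_3  *)
(* is its subring of S_3-invariants, so an equality in A is an equality in   *)
(* this ring.                                                                *)

Definition torus_rel : {mpoly int[3]} := \prod_(i < 3) 'X_i - 1.

Definition torus_ideal : {pred {mpoly int[3]}} := fun f =>
  if excluded_middle_informative (exists q, f = q * torus_rel)
  then true else false.

Lemma torus_idealP (f : {mpoly int[3]}) :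
  reflect (exists q, f = q * torus_rel) (torus_ideal f).
Proof.
by rewrite /torus_ideal; case: excluded_middle_informative => h; constructor.
Qed.

Lemma torus_ideal_closed : idealr_closed torus_ideal.
Proof.
split.
- by apply/torus_idealP; exists 0; rewrite mul0r.
- apply/negP => /torus_idealP [q /(congr1 (meval (fun=> 1)))].
  rewrite /torus_rel mevalM mevalB meval1 rmorph_prod /=.
  by rewrite big1 => [|i _]; rewrite ?mevalXU // subrr mulr0.
- move=> a u v /torus_idealP [q ->] /torus_idealP [r ->].
  by apply/torus_idealP; exists (a * q + r); rewrite mulrDl mulrA.
Qed.

HB.instance Definition _ :=
  isIdealr.Build {mpoly int[3]} torus_ideal torus_ideal_closed.

Definition torus_ring : Type := {ideal_quot torus_ideal}.

HB.instance Definition _ := GRing.ComNzRing.on torus_ring.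

Definition to_torus (f : {mpoly int[3]}) : torus_ring :=
  \pi_({ideal_quot torus_ideal})%qT f.

Fact to_torus_zmod_morphism : zmod_morphism to_torus.
Proof. exact: (raddfB (\pi_({ideal_quot torus_ideal})%qT)). Qed.

HB.instance Definition _ :=
  GRing.isZmodMorphism.Build {mpoly int[3]} torus_ring to_torus
    to_torus_zmod_morphism.

Fact to_torus_monoid_morphism : monoid_morphism to_torus.
Proof.
split; first exact: (rmorph1 (\pi_({ideal_quot torus_ideal})%qT)).
exact: (rmorphM (\pi_({ideal_quot torus_ideal})%qT)).
Qed.

HB.instance Definition _ :=
  GRing.isMonoidMorphism.Build {mpoly int[3]} torus_ring to_torus
    to_torus_monoid_morphism.

Lemma to_torusK (q : torus_ring) : to_torus (repr q) = q.
Proof. exact: reprK. Qed.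

Definition tvar (i : 'I_3) : torus_ring := to_torus 'X_i.

Lemma prod_tvar : \prod_(i < 3) tvar i = 1.
Proof.
rewrite -(rmorph_prod to_torus) -(rmorph1 to_torus).
apply/eqP; rewrite -subr_eq0 -rmorphB; apply/eqP.
rewrite -(raddf0 to_torus); apply/eqP; rewrite /to_torus -Quotient.idealrBE.
by rewrite subr0; apply/torus_idealP; exists 1; rewrite mul1r.
Qed.

Definition tvar_inv (i : 'I_3) : torus_ring := \prod_(j < 3 | j != i) tvar j.

Lemma tvarK (i : 'I_3) : tvar i * tvar_inv i = 1.
Proof. by rewrite -prod_tvar [RHS](bigD1 i). Qed.

(* Substitution x_i |-> u_i.  It is a well-defined ring endomorphism, i.e.   *)
(* independent of the representative, as soon as u_1 u_2 u_3 = 1.            *)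
Definition tsubst (u : 'I_3 -> torus_ring) (q : torus_ring) : torus_ring :=
  mmap intr u (repr q).

Lemma tsubstE (u : 'I_3 -> torus_ring) (f : {mpoly int[3]}) :
  \prod_(i < 3) u i = 1 -> tsubst u (to_torus f) = mmap intr u f.
Proof.
move=> u1; rewrite /tsubst; apply/eqP; rewrite -subr_eq0 -rmorphB.
have /torus_idealP [q ->] : torus_ideal (repr (to_torus f) - f).
  by move: (Quotient.idealrBE torus_ideal (repr (to_torus f)) f);
     rewrite reprK eqxx.
rewrite rmorphM /torus_rel rmorphB rmorph1 rmorph_prod /=.
rewrite (eq_bigr u) => [|i _]; last by rewrite mmapX mmap1U.
by rewrite u1 subrr mulr0.
Qed.

Section Substitution.

Variables (u : 'I_3 -> torus_ring) (u1 : \prod_(i < 3) u i = 1).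

Lemma tsubst_tvar (i : 'I_3) : tsubst u (tvar i) = u i.
Proof. by rewrite tsubstE // mmapX mmap1U. Qed.

Lemma tsubst_zmod_morphism : zmod_morphism (tsubst u).
Proof.
move=> x y; rewrite -[x]to_torusK -[y]to_torusK.
by rewrite -rmorphB !tsubstE // rmorphB.
Qed.

Lemma tsubst_monoid_morphism : monoid_morphism (tsubst u).
Proof.
split=> [|x y]; first by rewrite -[1 in LHS](rmorph1 to_torus) tsubstE // rmorph1.
rewrite -[x]to_torusK -[y]to_torusK.
by rewrite -rmorphM !tsubstE // rmorphM.
Qed.

End Substitution.

Definition char_dual : torus_ring -> torus_ring := tsubst tvar_inv.

Definition char_frob (p : nat) : torus_ring -> torus_ring :=
  tsubst (fun i => tvar i ^+ p).

Lemma prod_tvar_inv : \prod_(i < 3) tvar_inv i = 1.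
Proof.
rewrite -[LHS]mul1r -{1}prod_tvar -big_split /=.
by apply: big1 => i _; exact: tvarK.
Qed.

Lemma prod_tvarX (p : nat) : \prod_(i < 3) tvar i ^+ p = 1.
Proof. by rewrite prodrXl prod_tvar expr1n. Qed.

HB.instance Definition _ := GRing.isZmodMorphism.Build torus_ring torus_ring
  char_dual (tsubst_zmod_morphism prod_tvar_inv).
HB.instance Definition _ := GRing.isMonoidMorphism.Build torus_ring torus_ring
  char_dual (tsubst_monoid_morphism prod_tvar_inv).
HB.instance Definition _ p := GRing.isZmodMorphism.Build torus_ring torus_ring
  (char_frob p) (tsubst_zmod_morphism (prod_tvarX p)).
HB.instance Definition _ p := GRing.isMonoidMorphism.Build
  torus_ring torus_ring (char_frob p) (tsubst_monoid_morphism (prod_tvarX p)).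

Lemma char_dual_tvar (i : 'I_3) : char_dual (tvar i) = tvar_inv i.
Proof. exact: tsubst_tvar prod_tvar_inv i. Qed.

Lemma char_frob_tvar (p : nat) (i : 'I_3) : char_frob p (tvar i) = tvar i ^+ p.
Proof. exact: tsubst_tvar (prod_tvarX p) i. Qed.

(* T.1 and T.2 are the rows of a filling of the Young diagram of (a, b);     *)
(* zip pairs the entries in the same column.                                 *)
Definition is_ssyt (a b : nat) (T : a.-tuple 'I_3 * b.-tuple 'I_3) : bool :=
  [&& sorted (fun i j : 'I_3 => i <= j)%N T.1,
      sorted (fun i j : 'I_3 => i <= j)%N T.2
    & all (fun c : 'I_3 * 'I_3 => c.1 < c.2)%N (zip T.1 T.2)].

Definition schur_poly (a b : nat) : {mpoly int[3]} :=
  \sum_(T : a.-tuple 'I_3 * b.-tuple 'I_3 | is_ssyt T)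
     (\prod_(i <- T.1) 'X_i) * (\prod_(i <- T.2) 'X_i).

Definition schur (a b : int) : torus_ring :=
  if (0 <= b) && (b <= a) then to_torus (schur_poly `|a| `|b|) else 0.

(* sumn s is the sum of all the elements; the subtraction never truncates.   *)
Definition carry (p : nat) (s : seq nat) (i : nat) : nat :=
  (sumn s %/ p ^ i - \sum_(a <- s) (a %/ p ^ i))%N.

(* The carries with i > sumn s vanish (for p > 1), see even_carryP.          *)
Definition even_carry (p : nat) (s : seq nat) : bool :=
  all (fun i => ~~ odd (carry p s i)) (seq.iota 1 (sumn s)).

Lemma even_carryP (p : nat) (s : seq nat) : (1 < p)%N ->
  reflect (forall i, (1 <= i)%N -> ~~ odd (carry p s i)) (even_carry p s).
Proof.
move=> p_gt1; apply: (iffP allP) => h i; last first.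
  by rewrite mem_iota => /andP[+ _]; exact: h.
move=> i_gt0; have [le_is|lt_si] := leqP i (sumn s).
  by apply: h; rewrite mem_iota i_gt0 add1n ltnS.
by rewrite /carry divn_small // (ltn_trans lt_si) // ltn_expl.
Qed.

Definition even_carry_poly (p m : nat) : torus_ring :=
  \sum_(a1 < m) \sum_(a2 < m) \sum_(a3 < m |
      (a1 + a2 + a3 + 1 == m)%N
      && even_carry p [:: a1 : nat; a2 : nat; a3 : nat; 1%N])
    tvar 0 ^+ a1 * tvar 1 ^+ a2 * tvar 2 ^+ a3.

(* Exponents of the monomials of degree m in z_1,z_2,z_3.                    *)
Definition mons (m : nat) : Type := {a : 'X_{1..3 < m.+1} | mdeg a == m}.
HB.instance Definition _ m := Finite.on (mons m).

Definition mons_val (m : nat) (a : mons m) : 'X_{1..3} := val (val a).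

Fact mons_subproof (m : nat) (a : 'X_{1..3}) :
  mdeg a = m -> (mdeg a < m.+1)%N.
Proof. by move->. Qed.

Definition mk_mons (m : nat) (a : 'X_{1..3}) (ha : mdeg a = m) : mons m :=
  Sub (BMultinom (mons_subproof ha)) (introT eqP ha).

Fact mons_valP (m : nat) (a : mons m) : mdeg (mons_val a) = m.
Proof. exact: (eqP (valP a)). Qed.

Fact mons_addX_subproof (m : nat) (a : mons m) (i : 'I_3) :
  mdeg (mons_val a + U_(i))%MM = m.+1.
Proof. by rewrite mdegD mdeg1 mons_valP addn1. Qed.

Definition mons_addX (m : nat) (a : mons m) (i : 'I_3) : mons m.+1 :=
  mk_mons (mons_addX_subproof a i).

Fact mons_add_subproof (m n : nat) (a : mons m) (b : mons n) :
  mdeg (mons_val a + mons_val b)%MM = (m + n)%N.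
Proof. by rewrite mdegD !mons_valP. Qed.

Definition mons_add (m n : nat) (a : mons m) (b : mons n) : mons (m + n) :=
  mk_mons (mons_add_subproof a b).

Section IncidenceRepresentation.

Variable k : fieldType.

(* S^m V has the basis of monomials z^b.  D^d V = (S^d V^* )^* has the basis *)
(* z^(a) dual to the monomials of S^d(V^* ).  An element of a tensor product *)
(* of such spaces is given by its coordinates in the tensor product basis.   *)

(* D^d V (x) S^m V *)
Definition DS (d m : nat) := {ffun mons d * mons m -> k^o}.

(* D^d V (x) V (x) S^m V *)
Definition DVS (d m : nat) := {ffun mons d * 'I_3 * mons m -> k^o}.

(* Comultiplication D^{d+1} V -> D^d V (x) V is dual to the multiplication   *)
(* S^d V^* (x) V^* -> S^{d+1} V^*: it maps z^(c) to the sum of z^(a) (x) z_i *)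
(* over all (a, i) such that a + e_i = c.                                    *)
Definition comul_fun (d m : nat) (v : DS d.+1 m) : DVS d m :=
  [ffun c => v (mons_addX c.1.1 c.1.2, c.2)].

(* Multiplication V (x) S^m V -> S^{m+1} V maps z_i (x) z^b to z^(b + e_i).  *)
Definition mul_fun (d m : nat) (w : DVS d m) : DS d m.+1 :=
  [ffun c => \sum_(ib : 'I_3 * mons m | mons_addX ib.2 ib.1 == c.2)
               w (c.1, ib.1, ib.2)].

Fact comul_linear (d m : nat) : linear (@comul_fun d m).
Proof. by move=> a u v; apply/ffunP => c; rewrite !ffunE. Qed.

Fact mul_linear (d m : nat) : linear (@mul_fun d m).
Proof.
move=> a u v; apply/ffunP => c; rewrite !ffunE scaler_sumr -big_split /=.
by apply: eq_bigr => ib _; rewrite !ffunE.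
Qed.

HB.instance Definition _ (d m : nat) :=
  GRing.isLinear.Build k (DS d.+1 m) (DVS d m) _ (@comul_fun d m)
    (@comul_linear d m).
HB.instance Definition _ (d m : nat) :=
  GRing.isLinear.Build k (DVS d m) (DS d m.+1) _ (@mul_fun d m)
    (@mul_linear d m).

(* mu_map d m is the map usually denoted mu_{d+1,m+1}, and K_space d e is    *)
(* K(d,e) provided d, e >= 1.                                                *)
Definition mu_map (d m : nat) : 'Hom(DS d.+1 m, DS d m.+1) :=
  (linfun (@mul_fun d m) \o linfun (@comul_fun d m))%VF.

Definition K_space (d e : nat) : {vspace DS d.-1.+1 e.-1} :=
  lker (mu_map d.-1 e.-1).

(* The vector z^(a) (x) z^b spans a line of weight a + b.                    *)
Definition basis_vec (d m : nat) (c : mons d * mons m) : DS d m :=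
  [ffun c' => (c' == c)%:R].

Definition weight (d m : nat) (c : mons d * mons m) : mons (d + m) :=
  mons_add c.1 c.2.

Definition weight_space (d m : nat) (al : mons (d + m)) : {vspace DS d m} :=
  <<[seq basis_vec c | c in [pred c | weight c == al]]>>%VS.

Lemma mons_val_inj (m : nat) : injective (@mons_val m).
Proof. by move=> a b /val_inj /val_inj. Qed.

Lemma basis_vec_expand (d m : nat) (v : DS d m) :
  v = \sum_c v c *: basis_vec c.
Proof.
apply/ffunP => c; rewrite sum_ffunE (bigD1 c) //= !ffunE eqxx.
rewrite big1 => [|c' nc]; first by rewrite addr0 [RHS]mulr1.
by rewrite !ffunE eq_sym (negPf nc); exact: mulr0.
Qed.

Lemma mem_weight_space (d m : nat) (al : mons (d + m)) (v : DS d m) :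
  v \in weight_space al <-> forall c, v c != 0 -> weight c = al.
Proof.
split=> [|h].
  rewrite /weight_space -[image _ _]/(tval (in_tuple _)) => /coord_span -> c.
  rewrite sum_ffunE; apply: contra_neq_eq => nc; apply: big1 => i _.
  rewrite ffunE; have /imageP [c' /eqP wc' ->] := mem_nth 0 (ltn_ord i).
  rewrite ffunE; case: eqP => [cc'|_]; last exact: mulr0.
  by rewrite cc' wc' eqxx in nc.
rewrite [v]basis_vec_expand; apply: memv_suml => c _.
have [->|/h wc] := eqVneq (v c) 0; first by rewrite scale0r mem0v.
by apply/memvZ/memv_span/imageP; exists c; rewrite // inE wc.
Qed.

(* The weight spaces are those of the diagonal torus of SL_3, as a group     *)
(* scheme: a point t of the torus over an extension of k acts on             *)
(* z^(a) (x) z^b by t^(a + b), and al stands for the character t |-> t^al.   *)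
Lemma weight_spaceP (d m : nat) (al : mons (d + m)) (v : DS d m) :
  v \in weight_space al <->
  forall (L : fieldType) (f : {rmorphism k -> L}) (t : 'I_3 -> L),
    \prod_(i < 3) t i = 1 ->
    forall c, (\prod_(i < 3) t i ^+ mons_val (weight c) i) * f (v c) =
              (\prod_(i < 3) t i ^+ mons_val al i) * f (v c).
Proof.
split=> [/mem_weight_space h L f t _ c|h].
  have [->|/h ->//] := eqVneq (v c) 0.
  by rewrite rmorph0 !mulr0.
apply/mem_weight_space => c vc0; apply: mons_val_inj.
pose L : fieldType := {fraction {poly k}}.
pose f : {rmorphism k -> L} := (@tofrac {poly k}) \o polyC.
have X0 : tofrac 'X != 0 :> L by rewrite tofrac_eq0 polyX_eq0.
set w := weight c in h *.
have key (i j : 'I_3) :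
    (mons_val w i + mons_val al j = mons_val al i + mons_val w j)%N.
  have [->|nij] := eqVneq i j; first by rewrite addnC.
  pose t l : L := if l == i then tofrac 'X else if l == j then (tofrac 'X)^-1 else 1.
  have tE (F : 'X_{1..3}) :
      \prod_l t l ^+ F l = tofrac 'X ^+ F i * (tofrac 'X) ^- F j.
    rewrite (bigD1 i) //= (bigD1 j) 1?eq_sym //= big1 => [|l /andP [li lj]].
      by rewrite /t !eqxx eq_sym (negPf nij) mulr1 exprVn.
    by rewrite /t (negPf li) (negPf lj) expr1n.
  have t1 : \prod_l t l = 1.
    rewrite (bigD1 i) //= (bigD1 j) 1?eq_sym //= big1 => [|l /andP [li lj]].
      by rewrite /t !eqxx eq_sym (negPf nij) mulr1 mulfV.
    by rewrite /t (negPf li) (negPf lj).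
  have /(_ c) := h L f t t1; rewrite -/w !tE => /mulIf.
  rewrite fmorph_eq0 => /(_ vc0) /eqP.
  rewrite eqr_div ?expf_neq0 // -!exprD -!rmorphXn /= tofrac_eq => /eqP.
  by move=> /(congr1 (size \o val)) /=; rewrite !size_polyXn => -[].
apply/mnmP => i; apply/eqP; rewrite -(eqn_pmul2l (isT : 0 < 3)%N).
have : (\sum_(j < 3) (mons_val w i + mons_val al j) =
        \sum_(j < 3) (mons_val al i + mons_val w j))%N.
  by apply: eq_bigr => j _.
rewrite !big_split /= !sum_nat_const card_ord -!mdegE !mons_valP => /addIn ->.
by [].
Qed.

(* The weights of SL_3 are the classes of Z^3 modulo (1,1,1).  Those of      *)
(* D^d V (x) S^m V have a unique representative in mons (d + m).             *)
Definition char_of (d m : nat) (U : {vspace DS d m}) : torus_ring :=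
  \sum_(al : mons (d + m))
     (\dim (U :&: weight_space al)%VS)%:R * \prod_(i < 3) tvar i ^+ mons_val al i.

Definition kappa (d e : nat) : torus_ring := char_of (K_space d e).

End IncidenceRepresentation.

(* Main.v *)
From HB Require Import structures.
Require Import Defs.
From mathcomp Require Import all_boot all_order all_algebra.
From mathcomp Require Import mpoly zify ring.
Import GRing.Theory.
Local Open Scope ring_scope.
Set Implicit Arguments.
Unset Strict Implicit.
Unset Printing Implicit Defensive.

(** The multiplicity of a weight al in K(d,e) is the dimension of the kernel of
    multiplication by z_1 + z_2 + z_3, from degree e - 1 to degree e, on
    k[z_1,z_2,z_3]/(z_i^t_i), where t_i = al_i + 1 and t_1 + t_2 + t_3 = d+e+2.
    For r in this kernel, (z_1 + z_2 + z_3) r = F_1 + F_2 + F_3 with F_i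
    divisible by z_i^t_i, and restricting to the line z_1 + z_2 + z_3 = 0 gives
    three binary forms of degree e with sum 0 and prescribed orders of vanishing
    at three points of the projective line.  With the coordinate X for which the
    points are 0, infinity and -1, such a triple is a pair (f, h) of
    polynomials: X^t_1 divides f, (X+1)^t_3 divides h, and deg (f + h) <= e - t_2
    (pade).  If all t_i are at most d + 1, restriction is bijective, and its
    inverse is a synthetic division (boundary_inj, boundary_surj); otherwise the
    kernel is zero.

    Since t_1 + t_2 + t_3 > 2e, two such pairs are proportional (pade_cross), so
    all of them are multiples of one coprime pair (F, H).  If it has degree m
    and orders o_1, o_2, o_3 with sum > 2m + 1, the Wronskian of F and H has too
    many zeros and vanishes; then F and H are polynomials in X^p.  Iterating,
    F = F_0(X^q) and H = H_0(X^q) with q a power of p and (F_0, H_0) primitive: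
    its orders u_i and its degree m satisfy u_1 + u_2 + u_3 = 2m + 1
    (coprime_pair_descent).  Writing u_i = m - a_i gives a_1 + a_2 + a_3 + 1 = m,
    and counting the multiples of (F, H) gives the dimension cone_dim.

    It remains to know which triples (a_1, a_2, a_3) come from primitive pairs.
    A pair with the orders m - a_i in degree m exists by counting
    coefficients; it fails to be primitive exactly when it is a
    multiple of the pullback of a primitive pair along X -> X^q, q > 1, and
    comparing orders shows that this forces the carry of a_1 + a_2 + a_3 + 1 at q
    to be 1 (cone_dim_gt0_divn).  Carries are at most 2, so this never happens
    for even-carry triples; conversely the outermost odd carry does produce such
    a multiple (even_carry_primitive, primitive_even_carry).  Hence each
    multiplicity is a sum of numbers cone_dim over the powers of p and the
    even-carry triples with m = floor(e/q), at most one of which is nonzero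
    (dim_ker_weight_space).

    Finally, cone_dim as a function of al is a weight multiplicity of the
    Schur polynomial in the formula, translated by - q (a_1, a_2, a_3): both are
    lengths of the same interval of Gelfand-Tsetlin patterns (cone_dim_kostka,
    cone_character). *)

(** Sizes and multiplicities of the same polynomial reached through different
    algebraic structures are convertible but not syntactically equal; naming
    them first lets linear arithmetic identify them. *)
Ltac size_lia :=
  repeat (match goal with H : is_true (leq _ _) |- _ => revert H
          | H : @eq nat _ _ |- _ => revert H end);
  repeat (move: (size (polyseq _)) => ?); repeat (move: (mup _ _) => ?); lia.

(** * Pairs of polynomials with prescribed orders at 0, infinity and -1 *)

Section CoprimePairs.

Variable k : fieldType.
Implicit Types (f h g F G H : {poly k}).

Lemma dvdXn_mup f n : f != 0 -> ('X^n %| f) = (n <= mup 0 f)%N.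
Proof. by move=> f0; rewrite mup_geq // polyC0 subr0. Qed.

Lemma dvdX1n_mup f n : f != 0 -> (('X + 1) ^+ n %| f) = (n <= mup (-1) f)%N.
Proof. by move=> f0; rewrite mup_geq // polyCN opprK polyC1. Qed.

(** The pair (F, H) stands for the three forms F, H, -(F + H) of this common
    degree, whose orders of vanishing are measured at 0, at -1 and at infinity
    respectively. *)
Definition hdeg F H := (maxn (size F) (size H)).-1.
Definition mu_inf F H := ((hdeg F H).+1 - size (F + H)%R)%N.

Definition nondeg F H := [&& F != 0, H != 0 & F + H != 0].

Definition coprime_pair F H := nondeg F H && coprimep F H.

Definition pade e a b c f h :=
  [&& 'X^a %| f, ('X + 1) ^+ c %| h, (size f <= e.+1)%N, (size h <= e.+1)%N
    & (size (f + h)%R <= e.+1 - b)%N].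

Lemma coprimep_XnX1n a c : coprimep ('X^a) (('X + 1 : {poly k}) ^+ c).
Proof.
apply/coprimep_expl/coprimep_expr; apply/Bezout_coprimepP.
exists (-1, 1); rewrite /= (_ : _ + _ = 1) ?eqpxx //; ring.
Qed.

Lemma size_X1n c : size (('X + 1 : {poly k}) ^+ c) = c.+1.
Proof. by rewrite -[1]opprK -polyC1 -polyCN size_exp_XsubC. Qed.

Lemma X1n_neq0 c : ('X + 1 : {poly k}) ^+ c != 0.
Proof. by rewrite -size_poly_gt0 size_X1n. Qed.

(** The vanishing statements below rest on this: a polynomial with too many
    zeros at 0 and -1 for its degree is zero. *)
Lemma XnX1n_dvd_size a c f :
  'X^a %| f -> ('X + 1) ^+ c %| f -> f != 0 -> (a + c < size f)%N.
Proof.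
move=> da dc f0; have : 'X^a * ('X + 1) ^+ c %| f.
  by rewrite Gauss_dvdp ?da ?dc // coprimep_XnX1n.
move=> /(dvdp_leq f0); rewrite size_mul ?X1n_neq0 ?expf_neq0 ?polyX_eq0 //.
by rewrite size_polyXn size_X1n addnS.
Qed.

(** The module of pairs has rank one in this range: f h' - f' h vanishes to
    orders a and c at 0 and -1, and has degree at most 2e - b because h may be
    replaced by f + h. *)
Lemma pade_cross e a b c f h f' h' :
  pade e a b c f h -> pade e a b c f' h' -> (2 * e < a + b + c)%N ->
  f * h' = f' * h.
Proof.
move=> /and5P[fa hc sf sh sg] /and5P[fa' hc' sf' sh' sg'] lt_e.
apply/eqP; rewrite -subr_eq0; apply/negPn/negP=> D0.
have := XnX1n_dvd_size (dvdp_sub _ _) (dvdp_sub _ _) D0 => /(_ a c).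
rewrite !(dvdp_mulr _ fa) !(dvdp_mulr _ fa') !(dvdp_mull _ hc) !(dvdp_mull _ hc').
move=> /(_ isT isT isT isT).
have -> : f * h' - f' * h = f * (f' + h') - f' * (f + h) by ring.
have le1 : (size (f * (f' + h'))%R <= (2 * e).+1 - b)%N.
  have [->|n0] := eqVneq (f' + h') 0; first by rewrite mulr0 size_poly0.
  apply: leq_trans (size_polyMleq _ _) _.
  by move: n0; rewrite -size_poly_gt0; size_lia.
have le2 : (size (f' * (f + h))%R <= (2 * e).+1 - b)%N.
  have [->|n0] := eqVneq (f + h) 0; first by rewrite mulr0 size_poly0.
  apply: leq_trans (size_polyMleq _ _) _.
  by move: n0; rewrite -size_poly_gt0; size_lia.
have := size_polyD (f * (f' + h')) (- (f' * (f + h))).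
by rewrite size_polyN; size_lia.
Qed.

(** If one of the three forms is zero, the other two agree up to sign and
    vanish at two of the three points, which leaves no room in degree e. *)
Lemma pade_nondeg e a b c f h :
  (e < a + b)%N -> (e < a + c)%N -> (e < b + c)%N ->
  pade e a b c f h -> (f != 0) || (h != 0) -> nondeg f h.
Proof.
move=> ab ac bc /and5P[fa hc sf sh sg] nz.
have f0 : f != 0.
  apply: contraL nz => /eqP f0; rewrite f0 add0r in sg *; rewrite eqxx /=.
  rewrite negbK; apply/negPn/negP=> h0; have := dvdp_leq h0 hc.
  by rewrite size_X1n; size_lia.
have h0 : h != 0.
  apply: contraL nz => /eqP h0; rewrite h0 addr0 in sg *; rewrite eqxx orbF.
  by have := dvdp_leq f0 fa; rewrite size_polyXn; size_lia.
rewrite /nondeg f0 h0 /=; apply/eqP=> /eqP; rewrite addr_eq0 => /eqP fh.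
have fc : ('X + 1) ^+ c %| f by rewrite fh dvdpNr.
by have := XnX1n_dvd_size fa fc f0; size_lia.
Qed.

Lemma nondeg_factor f h : nondeg f h ->
  exists F H G, [/\ coprime_pair F H, G != 0, f = G * F & h = G * H].
Proof.
move=> /and3P[f0 h0 g0]; pose G := gcdp f h.
have G0 : G != 0 by rewrite gcdp_eq0 (negPf f0).
have fE : f = G * (f %/ G) by rewrite mulrC divpK // dvdp_gcdl.
have hE : h = G * (h %/ G) by rewrite mulrC divpK // dvdp_gcdr.
have cop : coprimep (f %/ G) (h %/ G) by apply: coprimep_div_gcd; rewrite f0.
move: fE hE cop; move: (f %/ G) (h %/ G) => F H fE hE cop.
exists F, H, G; split=> //; rewrite /coprime_pair cop andbT.
move: f0 h0 g0; rewrite fE hE -mulrDr !mulf_eq0 !negb_or /nondeg.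
by move=> /andP[_ ->] /andP[_ ->] /andP[_ ->].
Qed.

Lemma size_hdeg F H : F != 0 -> (size F <= (hdeg F H).+1)%N
  /\ (size H <= (hdeg F H).+1)%N.
Proof. by rewrite -size_poly_gt0 /hdeg; size_lia. Qed.

Lemma size_sum_hdeg F H : nondeg F H ->
  (size (F + H)%R + mu_inf F H = (hdeg F H).+1)%N.
Proof.
move=> /and3P[F0 H0 G0]; rewrite /mu_inf addnBA ?addKn //.
apply: leq_trans (size_polyD _ _) _.
by have := size_hdeg H F0; size_lia.
Qed.

Lemma mup_size (x : k) f : f != 0 -> (mup x f < size f)%N.
Proof.
move=> f0; have := mup_geq x (mup x f) f0; rewrite leqnn.
by move=> /esym/(dvdp_leq f0); rewrite size_exp_XsubC.
Qed.

(** The truncated differences are the orders of vanishing that the factor G has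
    to supply. *)
Lemma pade_mulE e a b c F H G : nondeg F H -> G != 0 ->
  pade e a b c (G * F) (G * H) =
  [&& (a - mup 0 F <= mup 0 G)%N, (c - mup (-1) H <= mup (-1) G)%N
    & (size G + hdeg F H + (b - mu_inf F H) <= e.+1)%N].
Proof.
move=> nd G0; have sS := size_sum_hdeg nd; case/and3P: (nd) => F0 H0 S0.
have [GF0 GH0] : G * F != 0 /\ G * H != 0 by rewrite !mulf_neq0.
rewrite /pade dvdXn_mup // dvdX1n_mup // -mulrDr.
rewrite !mupM // !(leq_subLR, addnC (mup _ G)); congr [&& _, _ & _].
rewrite !size_mul //.
have [sF sH] := size_hdeg H F0.
move: G0 F0 H0 S0; rewrite -!size_poly_gt0 => G0 F0 H0 S0.
have : hdeg F H = (size F).-1 \/ hdeg F H = (size H).-1 by rewrite /hdeg; size_lia.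
move: sS sF sH; move: (hdeg F H) (mu_inf F H) => m i.
move: G0 F0 H0 S0; move: (size G) (size F) (size H) (size (F + H)%R) => x y z w.
by move=> *; apply/idP/idP; size_lia.
Qed.

End CoprimePairs.

(** * Frobenius descent *)

Section Frobenius.

Variables (k : fieldType) (p : nat).
Hypothesis char_k : p \in [pchar k].
Implicit Types (f h g F G H l : {poly k}).

Let p_prime : prime p := pcharf_prime char_k.

Lemma dvdp_deriv l f n : l ^+ n %| f -> l ^+ n.-1 %| f^`().
Proof.
case: n => [_|n /= /dvdpP[g ->]]; first by rewrite expr0 dvd1p.
rewrite derivM deriv_exp /= dvdp_add //; first by rewrite exprS !dvdp_mull.
by rewrite dvdp_mull // -mulrnAl dvdp_mull.
Qed.

(** A Mason-Stothers argument: the Wronskian F' H - F H' loses only one order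
    of vanishing at each of the three points, so it is zero once the orders add
    up to at least 2 hdeg + 2; coprimality then makes F divide F', and H divide
    H'. *)
Lemma coprime_pair_deriv0 F H : coprime_pair F H ->
  ((2 * hdeg F H).+2 <= mup 0 F + mu_inf F H + mup (-1) H)%N ->
  F^`() = 0 /\ H^`() = 0.
Proof.
case/andP=> nd cop; have sS := size_sum_hdeg nd; case/and3P: (nd) => F0 H0 S0.
move=> le_m; have [sF sH] := size_hdeg H F0.
have da : 'X^(mup 0 F) %| F by rewrite dvdXn_mup.
have dc : ('X + 1) ^+ (mup (-1) H) %| H by rewrite dvdX1n_mup.
have W0 : F^`() * H = F * H^`().
  apply/eqP; rewrite -subr_eq0; apply/negPn/negP=> W0.
  have Wa : 'X ^+ (mup 0 F).-1 %| F^`() * H - F * H^`().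
    rewrite dvdp_sub //; first by rewrite dvdp_mulr // dvdp_deriv.
    by rewrite dvdp_mulr // (dvdp_trans _ da) // dvdp_exp2l ?leq_pred.
  have Wc : ('X + 1) ^+ (mup (-1) H).-1 %| F^`() * H - F * H^`().
    rewrite dvdp_sub //; last by rewrite dvdp_mull // dvdp_deriv.
    by rewrite dvdp_mull // (dvdp_trans _ dc) // dvdp_exp2l ?leq_pred.
  have lt_W := XnX1n_dvd_size Wa Wc W0.
  (* The order at infinity enters through F + H, which has smaller degree. *)
  have WE : F^`() * H - F * H^`() = F^`() * (F + H) - F * (F + H)^`().
    by rewrite derivD; ring.
  have le1 : (size (F^`() * (F + H))%R <= (size F + size (F + H)%R).-2)%N.
    apply: leq_trans (size_polyMleq _ _) _; have := lt_size_deriv F0.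
    by move: S0; rewrite -size_poly_gt0; clear; size_lia.
  have le2 : (size (F * (F + H)^`())%R <= (size F + size (F + H)%R).-2)%N.
    apply: leq_trans (size_polyMleq _ _) _; have := lt_size_deriv S0.
    by move: F0; rewrite -size_poly_gt0; clear; size_lia.
  have := size_polyD (F^`() * (F + H)) (- (F * (F + H)^`())).
  by rewrite size_polyN -WE; move: sS lt_W le1 le2 le_m sF; clear; size_lia.
have lt_dvd0 f g : f != 0 -> f %| g -> (size g < size f)%N -> g = 0.
  by move=> f0 d; apply: contraTeq => g0; rewrite -leqNgt dvdp_leq.
split; first apply: (lt_dvd0 F) (lt_size_deriv F0) => //.
  by rewrite -(Gauss_dvdpl _ cop) W0 dvdp_mulr.
apply: (lt_dvd0 H) (lt_size_deriv H0) => //.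
by rewrite coprimep_sym in cop; rewrite -(Gauss_dvdpr _ cop) -W0 dvdp_mull.
Qed.

Lemma deriv0_comp_polyXp f : f^`() = 0 -> exists g, f = g \Po 'X^p.
Proof.
move=> f'0; exists (\poly_(i < size f) f`_(i * p)).
have p0 := prime_gt0 p_prime.
apply/polyP=> i; rewrite coef_comp_poly_Xn // coef_poly.
have [/dvdnP[j ->]|ndv] := boolP (p %| i)%N.
  rewrite mulnK //; case: ltnP => // le_fj; rewrite nth_default //.
  by apply: leq_trans le_fj _; rewrite leq_pmulr.
case: i ndv => [|i ndv]; first by rewrite dvdn0.
have /eqP := congr1 (fun g : {poly k} => g`_i) f'0; rewrite coef_deriv coef0.
rewrite -mulr_natr mulf_eq0 => /orP[/eqP//|].
by rewrite -(dvdn_pcharf char_k) (negPf ndv).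
Qed.

Section Scaling.

Variable j : nat.
Let q := (p ^ j)%N.

Lemma pexpn_gt0 : (0 < q)%N. Proof. by rewrite expn_gt0 prime_gt0. Qed.

Lemma exprB_pexpn (R : comNzRingType) (x y : R) : p \in [pchar R] ->
  (x - y) ^+ q = x ^+ q - y ^+ q.
Proof.
move=> cR; apply/eqP; rewrite eq_sym subr_eq -exprDn_pchar ?subrK //.
by rewrite (eq_pnat _ (pcharf_eq cR)) pnatX pnat_id.
Qed.

Lemma mup_comp_polyXq (x : k) F : F != 0 -> x ^+ q = x ->
  mup x (F \Po 'X^q) = (q * mup x F)%N.
Proof.
move=> F0 xq; have := mup_geq x (mup x F) F0; rewrite leqnn => /esym/dvdpP[G FE].
have nr : ~~ root G x.
  apply/negP; rewrite root_factor_theorem => /dvdpP[G' GE].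
  have := mup_geq x (mup x F).+1 F0; rewrite ltnn => /esym/negP; apply.
  by rewrite {2}FE GE exprS -mulrA dvdp_mull.
rewrite {1}FE comp_polyM rmorphXn /= comp_polyB comp_polyX comp_polyC.
have -> : 'X^q - x%:P = ('X - x%:P) ^+ q.
  by rewrite exprB_pexpn ?pchar_poly // -rmorphXn xq.
rewrite mupMr; last by rewrite /root horner_comp hornerXn xq.
by rewrite -exprM mup_XsubCX eqxx.
Qed.

Lemma comp_polyXq_eq0 F : (F \Po 'X^q == 0) = (F == 0).
Proof. by rewrite comp_poly_eq0 // size_polyXn ltnS pexpn_gt0. Qed.

Lemma size_comp_polyXq F : F != 0 ->
  size (F \Po 'X^q) = (q * (size F).-1).+1.
Proof.
move=> F0; have := size_comp_poly F 'X^q; rewrite size_polyXn /= mulnC => <-.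
by rewrite prednK // size_poly_gt0 comp_polyXq_eq0.
Qed.

Lemma coprime_pair_comp F H :
  coprime_pair (F \Po 'X^q) (H \Po 'X^q) = coprime_pair F H.
Proof.
rewrite /coprime_pair /nondeg -comp_polyD !comp_polyXq_eq0; congr (_ && _).
apply/idP/idP=> [/coprimepP cop|]; last exact: coprimep_comp_poly.
apply/coprimepP => D dF dH.
have [D0|D0] := eqVneq D 0.
  have /cop : D \Po 'X^q %| F \Po 'X^q by rewrite dvdp_comp_poly.
  move=> /(_ (dvdp_comp_poly _ dH)).
  by rewrite D0 comp_poly0.
have /cop := dvdp_comp_poly 'X^q dF => /(_ (dvdp_comp_poly _ dH)).
rewrite -!size_poly_eq1 size_comp_polyXq // => /eqP[].
move/eqP; rewrite muln_eq0 eqn0Ngt pexpn_gt0 /=.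
by move: D0; rewrite -size_poly_gt0; size_lia.
Qed.

Lemma hdeg_comp F H : nondeg F H ->
  hdeg (F \Po 'X^q) (H \Po 'X^q) = (q * hdeg F H)%N.
Proof.
case/and3P=> F0 H0 _; rewrite /hdeg !size_comp_polyXq //.
move: F0 H0; rewrite -!size_poly_gt0.
by case: (size F) (size H) => [|x] [|y] // _ _; rewrite maxnSS /= -maxnMr maxnSS.
Qed.

Lemma mu_inf_comp F H : nondeg F H ->
  mu_inf (F \Po 'X^q) (H \Po 'X^q) = (q * mu_inf F H)%N.
Proof.
move=> nd; rewrite /mu_inf hdeg_comp // -comp_polyD.
case/and3P: nd => F0 H0 S0; rewrite size_comp_polyXq //.
move: S0; rewrite -size_poly_gt0; case: (size _) => // s _.
by rewrite !subSS mulnBr.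
Qed.

Lemma mup_comp0 F : F != 0 -> mup 0 (F \Po 'X^q) = (q * mup 0 F)%N.
Proof. by move=> F0; rewrite mup_comp_polyXq // expr0n eqn0Ngt pexpn_gt0. Qed.

Lemma mup_compN1 F : F != 0 -> mup (-1) (F \Po 'X^q) = (q * mup (-1) F)%N.
Proof.
move=> F0; rewrite mup_comp_polyXq // -[-1]sub0r exprB_pexpn //.
by rewrite expr1n expr0n eqn0Ngt pexpn_gt0.
Qed.

End Scaling.

(** Dividing exponents by p divides both the degree and the sum of the orders,
    hence also their excess; it stops exactly when the excess is 1. *)
Lemma coprime_pair_descent F H : coprime_pair F H ->
  (2 * hdeg F H < mup 0 F + mu_inf F H + mup (-1) H)%N ->
  exists j F0 H0, [/\ F = F0 \Po 'X^(p ^ j), H = H0 \Po 'X^(p ^ j),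
    coprime_pair F0 H0
    & (mup 0 F0 + mu_inf F0 H0 + mup (-1) H0 = (2 * hdeg F0 H0).+1)%N].
Proof.
move: {2}(hdeg F H) (leqnn (hdeg F H)) => n.
elim: n F H => [|n IHn] F H le_n cp lt_m.
  have nd := proj1 (andP cp); have [F0 H0 S0] := and3P nd; exfalso.
  move: S0 (mup_size 0 F0) (mup_size (-1) H0) (size_hdeg H F0).
  rewrite -size_poly_gt0; move: (size_sum_hdeg nd) le_n lt_m; clear.
  by move=> ? ? ? ? ? ? [? ?]; size_lia.
have [eq_m|ne] := eqVneq (mup 0 F + mu_inf F H + mup (-1) H)%N (2 * hdeg F H).+1.
  exists 0%N, F, H; rewrite expn0 expr1.
  by rewrite !comp_polyXr; split.
have [F' H'] : F^`() = 0 /\ H^`() = 0.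
  by apply: coprime_pair_deriv0 => //; rewrite ltn_neqAle eq_sym ne.
have [F1 FE] := deriv0_comp_polyXp F'; have [H1 HE] := deriv0_comp_polyXp H'.
have pE : p = (p ^ 1)%N by rewrite expn1.
rewrite FE HE pE in cp lt_m ne le_n *; rewrite coprime_pair_comp in cp.
have nd := proj1 (andP cp); have [F0 H0 S0] := and3P nd.
rewrite mup_comp0 // mup_compN1 // mu_inf_comp // hdeg_comp // -pE in lt_m le_n ne.
have p1 := prime_gt1 p_prime.
have lt_m1 : (2 * hdeg F1 H1 < mup 0 F1 + mu_inf F1 H1 + mup (-1) H1)%N.
  by rewrite -(ltn_pmul2l (prime_gt0 p_prime)); move: lt_m; clear; lia.
have le_n1 : (hdeg F1 H1 <= n)%N.
  have [//|lt_n] := leqP (hdeg F1 H1) n.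
  by move: le_n lt_n p1; clear; nia.
have [j [F2 [H2 [-> -> cp2 eq2]]]] := IHn _ _ le_n1 cp lt_m1.
exists j.+1, F2, H2; split=> //.
  by rewrite -comp_polyA comp_Xn_poly -exprM -expnD add1n.
by rewrite -comp_polyA comp_Xn_poly -exprM -expnD add1n.
Qed.

End Frobenius.

(** * Carries of a_1 + a_2 + a_3 + 1 *)

Section Carries.

Local Open Scope nat_scope.

(** Number of free coefficients in a multiple, of degree at most e and with
    orders t_1, t_2, t_3, of the pullback along X -> X^q of a pair of degree m
    with orders m - a_1, m - a_2, m - a_3. *)
Definition cone_dim (e t1 t2 t3 q a1 a2 a3 : nat) : nat :=
  let m := (a1 + a2 + a3).+1 in
  e.+1 - (q * m + (t1 - q * (m - a1)) + (t2 - q * (m - a2))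
                + (t3 - q * (m - a3))).

Lemma divn_interval q a b : q * b <= a < q * b + q -> a %/ q = b.
Proof.
case/andP=> le_ba lt_ab; rewrite -(subnK le_ba) addnC mulnC divnMDl; last by lia.
by rewrite divn_small ?addn0 //; lia.
Qed.

Lemma subSn_sum3 a1 a2 a3 :
  [/\ (a1 + a2 + a3).+1 - a1 = (a2 + a3).+1,
      (a1 + a2 + a3).+1 - a2 = (a1 + a3).+1
    & (a1 + a2 + a3).+1 - a3 = (a1 + a2).+1].
Proof. by split; lia. Qed.

(** Eliminating truncated differences through this bound keeps the arithmetic
    linear without case distinctions. *)
Lemma leq_add_subn x y : x <= y + (x - y).
Proof. by rewrite -leq_subLR. Qed.

Lemma cone_dimE e t1 t2 t3 q a1 a2 a3 :
  cone_dim e t1 t2 t3 q a1 a2 a3 =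
    e.+1 - (q * a1 + q * a2 + q * a3 + q + (t1 - (q * a2 + q * a3 + q))
             + (t2 - (q * a1 + q * a3 + q)) + (t3 - (q * a1 + q * a2 + q))).
Proof.
rewrite /cone_dim -!mulnDr -!mulnSr.
by have [-> -> ->] := subSn_sum3 a1 a2 a3.
Qed.

(** The orders m - a_i in degree m leave so little room (their sum is 2m + 1)
    that a pullback from level q fits only if all the remainders a_i - q b_i
    lie in [0, q). *)
Lemma cone_dim_gt0_divn q a1 a2 a3 b1 b2 b3 : 1 < q ->
  let m := (a1 + a2 + a3).+1 in
  0 < cone_dim m (m - a1) (m - a2) (m - a3) q b1 b2 b3 ->
  [/\ a1 %/ q = b1, a2 %/ q = b2, a3 %/ q = b3 & m %/ q = (b1 + b2 + b3).+1].
Proof.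
move=> q_gt1 m; rewrite cone_dimE.
have [-> -> ->] := subSn_sum3 a1 a2 a3.
rewrite subn_gt0 ltnS; move: (leq_add_subn (a2 + a3).+1 (q * b2 + q * b3 + q)).
move: (leq_add_subn (a1 + a3).+1 (q * b1 + q * b3 + q)).
move: (leq_add_subn (a1 + a2).+1 (q * b1 + q * b2 + q)).
do 3 move: (_ - _) => ?; rewrite /m; clear=> *.
by split; apply: divn_interval; rewrite ?mulnS ?mulnDr; apply/andP; split; lia.
Qed.

(** Conversely, when the carry at q is 1, the pullback from the digits above q
    fits: the remainders add up to q - 1 plus that of m, and each is less than
    q. *)
Lemma cone_dim_odd_carry q a1 a2 a3 : 1 < q ->
  let m := (a1 + a2 + a3).+1 in
  m %/ q = (a1 %/ q + a2 %/ q + a3 %/ q).+1 ->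
  0 < cone_dim m (m - a1) (m - a2) (m - a3) q (a1 %/ q) (a2 %/ q) (a3 %/ q).
Proof.
move=> q_gt1 m mE; have q_gt0 : 0 < q by lia.
rewrite cone_dimE.
have [-> -> ->] := subSn_sum3 a1 a2 a3.
have := divn_eq m q; rewrite mE mulSn !mulnDl.
have := divn_eq a1 q; have := divn_eq a2 q; have := divn_eq a3 q.
have := ltn_pmod a1 q_gt0; have := ltn_pmod a2 q_gt0; have := ltn_pmod a3 q_gt0.
have := ltn_pmod m q_gt0; rewrite !(mulnC q).
move: (a1 %/ q * q) (a2 %/ q * q) (a3 %/ q * q) (a1 %% q) (a2 %% q) (a3 %% q).
move: (m %% q) => r; rewrite /m => {mE m} A1 A2 A3 r1 r2 r3 ltr ltr3 ltr2 ltr1.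
move=> -> -> -> eqm; rewrite subn_gt0 ltnS.
have -> : (A2 + r2 + (A3 + r3)).+1 - (A2 + A3 + q) = r - r1 by lia.
have -> : (A1 + r1 + (A3 + r3)).+1 - (A1 + A3 + q) = r - r2 by lia.
have -> : (A1 + r1 + (A2 + r2)).+1 - (A1 + A2 + q) = r - r3 by lia.
suff : r - r1 + (r - r2) + (r - r3) <= r by lia.
by case: (leqP r r1) (leqP r r2) (leqP r r3) => [] ? [] ? [] ?; lia.
Qed.

Variable p : nat.
Hypothesis p_prime : prime p.

Definition even_carry3 (a1 a2 a3 : nat) : bool := even_carry p [:: a1; a2; a3; 1].

Lemma prime_expn_gt1 j : 0 < j -> 1 < p ^ j.
Proof. by move=> j_gt0; apply: leq_trans (ltn_expl j (prime_gt1 p_prime)). Qed.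

(** The summand 1 contributes nothing above the lowest digit, so the carry is
    that of three summands plus 1, at most 2; even therefore means different
    from 1. *)
Lemma carry3E a1 a2 a3 j : 0 < j ->
  let c := carry p [:: a1; a2; a3; 1] j in
  (a1 + a2 + a3).+1 %/ p ^ j = a1 %/ p ^ j + a2 %/ p ^ j + a3 %/ p ^ j + c
  /\ c <= 2.
Proof.
move=> /prime_expn_gt1; rewrite /carry /= !big_cons big_nil.
move: (p ^ j) => q q_gt1; have q_gt0 : 0 < q by lia.
rewrite (divn_small q_gt1) !addn0 addn1 !addnS !addnA.
set m := (a1 + a2 + a3).+1.
have lb : a1 %/ q + a2 %/ q + a3 %/ q <= m %/ q.
  rewrite leq_divRL // !mulnDl.
  by have := leq_trunc_div a1 q; have := leq_trunc_div a2 q;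
     have := leq_trunc_div a3 q; rewrite /m; lia.
have ub : m %/ q <= a1 %/ q + a2 %/ q + a3 %/ q + 2.
  rewrite -ltnS ltn_divLR // !(mulSn, mulnDl).
  have := divn_eq a1 q; have := divn_eq a2 q; have := divn_eq a3 q.
  have := ltn_pmod a1 q_gt0; have := ltn_pmod a2 q_gt0.
  by have := ltn_pmod a3 q_gt0; rewrite /m; lia.
by split; lia.
Qed.

Lemma even_carry3P a1 a2 a3 : reflect
  (forall j, 0 < j ->
     (a1 + a2 + a3).+1 %/ p ^ j <> (a1 %/ p ^ j + a2 %/ p ^ j + a3 %/ p ^ j).+1)
  (even_carry3 a1 a2 a3).
Proof.
apply: (iffP (even_carryP _ (prime_gt1 p_prime))) => h j j_gt0.
  have := h j j_gt0; have [-> _] := carry3E a1 a2 a3 j_gt0.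
  by case: carry => [|[|c]]; lia.
have := h j j_gt0; have [-> ] := carry3E a1 a2 a3 j_gt0.
by case: carry => [|[|[|c]]] //; lia.
Qed.

(** Carries at levels above q are the carries of the truncated triple, so
    truncating at the largest level with an odd carry leaves only even ones. *)
Lemma odd_carry_max a1 a2 a3 : ~~ even_carry3 a1 a2 a3 ->
  exists2 j, 0 < j & let q := p ^ j in
    (a1 + a2 + a3).+1 %/ q = (a1 %/ q + a2 %/ q + a3 %/ q).+1
    /\ even_carry3 (a1 %/ q) (a2 %/ q) (a3 %/ q).
Proof.
move=> nec; pose P j := (0 < j) &&
  ((a1 + a2 + a3).+1 %/ p ^ j == (a1 %/ p ^ j + a2 %/ p ^ j + a3 %/ p ^ j).+1).
have exP : exists j, P j.
  move: nec; rewrite /even_carry3 => /allPn[j]; rewrite mem_iota => /andP[j_gt0 _].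
  rewrite negbK => oddc; exists j; rewrite /P j_gt0 /=.
  have [-> le2] := carry3E a1 a2 a3 j_gt0.
  by move: oddc le2; case: carry => [|[|[|c]]] //= _ _; rewrite addn1.
have ubP j : P j -> j <= (a1 + a2 + a3).+1.
  case/andP=> _ /eqP eqj; rewrite leqNgt; apply/negP=> lt_j.
  by move: eqj; rewrite divn_small // (ltn_trans lt_j) // ltn_expl // prime_gt1.
case: (ex_maxnP exP ubP) => j /andP[j_gt0 /eqP Pj] maxj; exists j => //.
split=> //; apply/even_carry3P=> i i_gt0; rewrite -Pj -!divnMA -expnD => eqi.
have /maxj : P (j + i) by rewrite /P addn_gt0 j_gt0; apply/eqP.
by lia.
Qed.

End Carries.

(** * Primitive pairs and the spaces they generate *)

Section Primitive.

Variables (k : fieldType) (p : nat).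
Hypothesis char_k : p \in [pchar k].
Implicit Types (f h g F G H : {poly k}).

Let p_prime : prime p := pcharf_prime char_k.

(** The orders are m - a_1, m - a_2, m - a_3 for the degree m = a_1 + a_2 + a_3
    + 1; their sum is 2m + 1. *)
Definition primitive_pair F H (a1 a2 a3 : nat) :=
  [/\ coprime_pair F H, hdeg F H = (a1 + a2 + a3).+1, mup 0 F = (a2 + a3).+1,
      mu_inf F H = (a1 + a3).+1 & mup (-1) H = (a1 + a2).+1].

Lemma primitive_pair_excess F H : coprime_pair F H ->
  (mup 0 F + mu_inf F H + mup (-1) H = (2 * hdeg F H).+1)%N ->
  exists a1 a2 a3, primitive_pair F H a1 a2 a3.
Proof.
move=> cp eqm; have nd := proj1 (andP cp); have [F0 H0 S0] := and3P nd.
have [le1 le2 le3] : [/\ mup 0 F <= hdeg F H, mu_inf F H <= hdeg F H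
                        & mup (-1) H <= hdeg F H]%N.
  have [sF sH] := size_hdeg H F0; have sS := size_sum_hdeg nd.
  split; rewrite -ltnS.
  - by apply: leq_trans sF; apply: mup_size.
  - by move: S0; rewrite -size_poly_gt0 -sS; clear; size_lia.
  - by apply: leq_trans sH; apply: mup_size.
exists (hdeg F H - mup 0 F)%N, (hdeg F H - mu_inf F H)%N, (hdeg F H - mup (-1) H)%N.
by split=> //; move: eqm le1 le2 le3; clear; lia.
Qed.

Lemma descent_primitive F H : coprime_pair F H ->
  (2 * hdeg F H < mup 0 F + mu_inf F H + mup (-1) H)%N ->
  exists j F0 H0 a1 a2 a3,
    [/\ F = F0 \Po 'X^(p ^ j), H = H0 \Po 'X^(p ^ j)
      & primitive_pair F0 H0 a1 a2 a3].
Proof.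
move=> cp /(coprime_pair_descent char_k cp)[j [F0 [H0 [FE HE cp0 eq0]]]].
have [a1 [a2 [a3 pr]]] := primitive_pair_excess cp0 eq0.
by exists j, F0, H0, a1, a2, a3.
Qed.

Lemma pade_primitive e t1 t2 t3 j F H a1 a2 a3 G :
  primitive_pair F H a1 a2 a3 -> G != 0 -> let q := (p ^ j)%N in
  pade e t1 t2 t3 (G * (F \Po 'X^q)) (G * (H \Po 'X^q)) =
  [&& (t1 - q * (a2 + a3).+1 <= mup 0 G)%N, (t3 - q * (a1 + a2).+1 <= mup (-1) G)%N
    & (size G + q * (a1 + a2 + a3).+1 + (t2 - q * (a1 + a3).+1) <= e.+1)%N].
Proof.
case=> cp hd m0 mi m1 G0 q; have cpq : coprime_pair (F \Po 'X^q) (H \Po 'X^q).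
  by rewrite coprime_pair_comp.
have nd := proj1 (andP cp); have [F0 H0 _] := and3P nd.
rewrite pade_mulE // ?(proj1 (andP cpq)) // mup_comp0 // mup_compN1 //.
by rewrite mu_inf_comp // hdeg_comp // hd m0 mi m1.
Qed.

Lemma mup_XnX1n x y : mup 0 ('X^x * ('X + 1 : {poly k}) ^+ y) = x /\
  mup (-1) ('X^x * ('X + 1 : {poly k}) ^+ y) = y.
Proof.
have mX z n : mup z ('X^n : {poly k}) = if 0 == z then n else 0%N.
  by rewrite -[X in X ^+ n]subr0 -polyC0 mup_XsubCX.
have mX1 z n : mup z (('X + 1 : {poly k}) ^+ n) = if -1 == z then n else 0%N.
  by rewrite -[1]opprK -[1]polyC1 -polyCN mup_XsubCX.
have X1n0 : ('X + 1 : {poly k}) ^+ y != 0 by apply: X1n_neq0.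
rewrite !mupM ?X1n0 ?expf_neq0 ?polyX_eq0 // !mX !mX1 !eqxx.
by rewrite [0 == -1]eq_sym oppr_eq0 oner_eq0 addn0.
Qed.

Lemma mup_factor x y G : G != 0 -> (x <= mup 0 G)%N -> (y <= mup (-1) G)%N ->
  exists G', G = G' * ('X^x * ('X + 1) ^+ y).
Proof.
move=> G0 hx hy; apply/dvdpP; rewrite Gauss_dvdp ?coprimep_XnX1n //.
by rewrite dvdXn_mup // dvdX1n_mup // hx.
Qed.

Lemma size_XnX1n x y : size ('X^x * ('X + 1 : {poly k}) ^+ y) = (x + y).+1.
Proof.
by rewrite size_mul ?X1n_neq0 ?expf_neq0 ?polyX_eq0 // size_polyXn size_X1n addnS.
Qed.

Lemma mulXnX1n_neq0 G x y :
  (G * ('X^x * ('X + 1) ^+ y) == 0) = (G == 0).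
Proof. by rewrite mulf_eq0 -[_ * _ ^+ _ == 0]size_poly_eq0 size_XnX1n orbF. Qed.

Lemma pade_primitive_mul e t1 t2 t3 j F H a1 a2 a3 G :
  primitive_pair F H a1 a2 a3 -> G != 0 -> let q := (p ^ j)%N in
  pade e t1 t2 t3 (G * (F \Po 'X^q)) (G * (H \Po 'X^q)) <->
  exists2 G' : {poly k}, (size G' <= cone_dim e t1 t2 t3 q a1 a2 a3)%N
    & G = G' * ('X^(t1 - q * (a2 + a3).+1) * ('X + 1) ^+ (t3 - q * (a1 + a2).+1)).
Proof.
move=> pr G0 q; rewrite (pade_primitive _ _ _ _ _ pr G0) -/q cone_dimE.
rewrite !(mulnSr, mulnDr) !addnA; move: (t1 - _)%N (t2 - _)%N (t3 - _)%N => x z y.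
split=> [/and3P[hx hy hs]|[G' sG' GE]].
  have [G' GE] := mup_factor G0 hx hy; exists G' => //.
  move: hs; rewrite GE size_mul -?size_poly_eq0 ?size_XnX1n //; last first.
    by move: G0; rewrite GE mulXnX1n_neq0 size_poly_eq0.
  have: (0 < size G')%N by move: G0; rewrite GE mulXnX1n_neq0 size_poly_gt0.
  by clear; size_lia.
have G'0 : G' != 0 by move: G0; rewrite GE mulXnX1n_neq0.
have [m0 m1] := mup_XnX1n x y; apply/and3P; split.
- by rewrite GE mupM ?m0 ?leq_addl // -size_poly_eq0 size_XnX1n.
- by rewrite GE mupM ?m1 ?leq_addl // -size_poly_eq0 size_XnX1n.
rewrite GE size_mul // ?size_XnX1n; last by rewrite -size_poly_eq0 size_XnX1n.
by move: G'0 sG'; rewrite -size_poly_gt0; clear; size_lia.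
Qed.

(** A pair proportional to a coprime one is a multiple of it. *)
Lemma coprime_pair_rank1 F H f h : coprime_pair F H -> f * H = F * h ->
  exists G, f = G * F /\ h = G * H.
Proof.
case/andP=> /and3P[F0 H0 _] cop eqf.
have /dvdpP[G fE] : F %| f by rewrite -(Gauss_dvdpl _ cop) eqf dvdp_mulr.
exists G; split=> //; apply: (mulfI F0); rewrite -eqf fE; ring.
Qed.

Lemma pade_primitive_exists e t1 t2 t3 j F H a1 a2 a3 :
  primitive_pair F H a1 a2 a3 -> (0 < cone_dim e t1 t2 t3 (p ^ j) a1 a2 a3)%N ->
  exists2 M : {poly k}, M != 0
    & pade e t1 t2 t3 (M * (F \Po 'X^(p ^ j))) (M * (H \Po 'X^(p ^ j))).
Proof.
move=> pr N_gt0.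
pose M : {poly k} := 'X^(t1 - p ^ j * (a2 + a3).+1)
                      * ('X + 1) ^+ (t3 - p ^ j * (a1 + a2).+1).
have M0 : M != 0 by rewrite -size_poly_eq0 size_XnX1n.
exists M => //; apply/(pade_primitive_mul e t1 t2 t3 j pr M0).
by exists 1; rewrite ?size_poly1 ?mul1r.
Qed.

(** By rank one every pair is a multiple of the pullback of (F, H); the factor
    has to contain the monomial M that supplies the missing orders at 0 and -1,
    and the rest of it is limited only in degree. *)
Lemma pade_primitive_space e t1 t2 t3 j F H a1 a2 a3 :
  primitive_pair F H a1 a2 a3 -> (2 * e < t1 + t2 + t3)%N ->
  let N := cone_dim e t1 t2 t3 (p ^ j) a1 a2 a3 in (0 < N)%N ->
  exists F1 H1, F1 != 0 /\ forall f h, pade e t1 t2 t3 f h <->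
    exists2 G : {poly k}, (size G <= N)%N & f = G * F1 /\ h = G * H1.
Proof.
move=> pr lt_e; pose q := (p ^ j)%N; rewrite -/q => N N_gt0.
pose M : {poly k} := 'X^(t1 - q * (a2 + a3).+1) * ('X + 1) ^+ (t3 - q * (a1 + a2).+1).
have M0 : M != 0 by rewrite -size_poly_eq0 size_XnX1n.
have [cp _ _ _ _] := pr; have cpq : coprime_pair (F \Po 'X^q) (H \Po 'X^q).
  by rewrite coprime_pair_comp.
have [Fq0 Hq0 _] := and3P (proj1 (andP cpq)).
have padeM : pade e t1 t2 t3 (M * (F \Po 'X^q)) (M * (H \Po 'X^q)).
  apply/(pade_primitive_mul e t1 t2 t3 j pr M0).
  by exists 1; rewrite ?size_poly1 ?mul1r.
exists (M * (F \Po 'X^q)), (M * (H \Po 'X^q)).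
split=> [|f h]; first by rewrite mulf_neq0.
split=> [pfh|[G sG [-> ->]]].
  have := pade_cross pfh padeM lt_e => /eqP.
  rewrite mulrCA -mulrA (inj_eq (mulfI M0)) => /eqP /(coprime_pair_rank1 cpq).
  case=> G [fE hE]; have [G0|G0] := eqVneq G 0.
    exists 0; first by rewrite size_poly0.
    by rewrite fE hE G0 !mul0r.
  move: pfh; rewrite fE hE => /(pade_primitive_mul e t1 t2 t3 j pr G0)[G' sG' ->].
  by exists G' => //; rewrite !mulrA.
have [->|G0] := eqVneq G 0.
  by rewrite !mul0r /pade !dvdp0 add0r size_poly0 !leq0n.
rewrite [G * (M * (F \Po _))]mulrA [G * (M * (H \Po _))]mulrA.
apply/(pade_primitive_mul e t1 t2 t3 j pr (mulf_neq0 G0 M0)).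
by exists G.
Qed.

Lemma coprime_pair_assoc F H F' H' : coprime_pair F H -> coprime_pair F' H' ->
  F * H' = F' * H ->
  [/\ hdeg F H = hdeg F' H', mup 0 F = mup 0 F', mu_inf F H = mu_inf F' H'
    & mup (-1) H = mup (-1) H'].
Proof.
move=> cp cp' eqF; have [G [FE HE]] := coprime_pair_rank1 cp' eqF.
have [/and3P[F0 H0 S0] cop] := andP cp; have [/and3P[F0' H0' S0'] _] := andP cp'.
have sG : size G = 1%N.
  apply/eqP; rewrite size_poly_eq1.
  by move/coprimepP: cop; apply; rewrite ?FE ?HE dvdp_mulr.
have G0 : G != 0 by rewrite -size_poly_gt0 sG.
have mu x : mup x G = 0%N by have := mup_size x G0; rewrite sG; case: mup.
have sGf f : f != 0 -> size (G * f) = size f.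
  by move=> f0; rewrite size_mul // sG.
rewrite /mu_inf /hdeg FE HE -mulrDr !sGf // !mupM // !mu !add0n.
by split.
Qed.

(** The coprime generator is unique up to a scalar, so q m and the q (m - a_i)
    are determined; q is recovered as the sum of the orders minus twice the
    degree. *)
Lemma primitive_pair_uniq e t1 t2 t3 i j F H F' H' a1 a2 a3 b1 b2 b3 :
  primitive_pair F H a1 a2 a3 -> primitive_pair F' H' b1 b2 b3 ->
  (2 * e < t1 + t2 + t3)%N ->
  (0 < cone_dim e t1 t2 t3 (p ^ i) a1 a2 a3)%N ->
  (0 < cone_dim e t1 t2 t3 (p ^ j) b1 b2 b3)%N ->
  [/\ i = j, a1 = b1, a2 = b2 & a3 = b3].
Proof.
move=> pr pr' lt_e ca cb; have [cp hd m0 mi m1] := pr.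
have [cp' hd' m0' mi' m1'] := pr'.
have cpi : coprime_pair (F \Po 'X^(p ^ i)) (H \Po 'X^(p ^ i)).
  by rewrite coprime_pair_comp.
have cpj : coprime_pair (F' \Po 'X^(p ^ j)) (H' \Po 'X^(p ^ j)).
  by rewrite coprime_pair_comp.
have [M M0 pM] := pade_primitive_exists pr ca.
have [M' M'0 pM'] := pade_primitive_exists pr' cb.
have eqF : (F \Po 'X^(p ^ i)) * (H' \Po 'X^(p ^ j)) =
           (F' \Po 'X^(p ^ j)) * (H \Po 'X^(p ^ i)).
  apply: (mulfI (mulf_neq0 M0 M'0)); rewrite mulrACA (pade_cross pM pM' lt_e).
  by rewrite [M * M']mulrC mulrACA.
have [F0 H0 _] := and3P (proj1 (andP cp)).
have [F0' H0' _] := and3P (proj1 (andP cp')).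
have [] := coprime_pair_assoc cpi cpj eqF.
have [nd nd'] := (proj1 (andP cp), proj1 (andP cp')).
rewrite !mup_comp0 // !mup_compN1 // !mu_inf_comp // !hdeg_comp //.
rewrite hd hd' m0 m0' mi mi' m1 m1' !(mulnSr, mulnDr).
have qE : (p ^ i = p ^ j)%N -> i = j by apply: expnI; apply: prime_gt1.
have [i0 j0] : (0 < p ^ i /\ 0 < p ^ j)%N by rewrite !expn_gt0 prime_gt0.
(* e2 + e3 + e4 - 2 e1 is the equality of the two powers of p. *)
move=> e1 e2 e3 e4; have eqq : (p ^ i = p ^ j)%N by move: e1 e2 e3 e4; clear; lia.
split; first exact: qE.
- by apply/eqP; rewrite -(eqn_pmul2l i0) {2}eqq; apply/eqP;
    move: eqq e1 e2 e3 e4; clear; lia.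
- by apply/eqP; rewrite -(eqn_pmul2l i0) {2}eqq; apply/eqP;
    move: eqq e1 e2 e3 e4; clear; lia.
- by apply/eqP; rewrite -(eqn_pmul2l i0) {2}eqq; apply/eqP;
    move: eqq e1 e2 e3 e4; clear; lia.
Qed.

End Primitive.

(** * Primitive pairs and even carries *)

Section EvenCarryCount.

Variables (k : fieldType) (p : nat).
Hypothesis char_k : p \in [pchar k].
Implicit Types (f h g F G H : {poly k}).

Let p_prime : prime p := pcharf_prime char_k.

Lemma linear_kernel_neq0 m n (L : {linear 'rV[k]_m -> 'rV[k]_n}) :
  (n < m)%N -> exists2 u, u != 0 & L u = 0.
Proof.
move=> lt_nm; pose A := lin1_mx L.
have : kermx A != 0.
  rewrite kermx_eq0 /row_free neq_ltn (leq_ltn_trans _ lt_nm) //.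
  exact: rank_leq_col.
case/rowV0Pn=> u /sub_kermxP uA u0; exists u => //.
by rewrite -mul_rV_lin1.
Qed.

(** There are a_1 + a_3 + 2 free coefficients, and the condition at infinity
    imposes a_1 + a_3 + 1 linear equations. *)
Lemma pade_neq0_exists a1 a2 a3 : exists f h, ((f != 0) || (h != 0)) /\
  pade (a1 + a2 + a3).+1 (a2 + a3).+1 (a1 + a3).+1 (a1 + a2).+1 f h.
Proof.
pose fu (u : 'rV[k]_(a1.+1 + a3.+1)) := 'X^((a2 + a3).+1) * rVpoly (lsubmx u).
pose hu (u : 'rV[k]_(a1.+1 + a3.+1)) :=
  ('X + 1) ^+ ((a1 + a2).+1) * rVpoly (rsubmx u).
pose L u := \row_(i < (a1 + a3).+1) (fu u + hu u)`_(a2.+1 + i).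
have L_lin : linear L.
  move=> c u v; apply/rowP=> i; rewrite !mxE /fu /hu !linearP /=.
  rewrite !mulrDr -!scalerAr !coefD !coefZ; ring.
pose Ll : {linear _ -> _} := HB.pack L (GRing.isLinear.Build k _ _ _ L L_lin).
have [|u u0 Lu] := linear_kernel_neq0 Ll; first by lia.
exists (fu u), (hu u).
have sf : (size (fu u) <= (a1 + a2 + a3).+2)%N.
  apply: leq_trans (size_polyMleq _ _) _; rewrite size_polyXn.
  by have := size_poly a1.+1 (fun i => if insub i is Some j then (lsubmx u) 0 j else 0);
    rewrite /rVpoly; clear; size_lia.
have sh : (size (hu u) <= (a1 + a2 + a3).+2)%N.
  apply: leq_trans (size_polyMleq _ _) _; rewrite size_X1n.
  by have := size_poly a3.+1 (fun i => if insub i is Some j then (rsubmx u) 0 j else 0);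
    rewrite /rVpoly; clear; size_lia.
split.
  rewrite -negb_and; apply: contra u0 => /andP[].
  rewrite !mulf_eq0 (negPf (X1n_neq0 _ _)) expf_eq0 polyX_eq0 andbF /=.
  move=> /eqP l0 /eqP r0.
  rewrite -[u]hsubmxK -[lsubmx u]rVpolyK -[rsubmx u]rVpolyK l0 r0.
  by rewrite !linear0 row_mx0.
rewrite /pade !dvdp_mulr // sf sh /=; apply/leq_sizeP => i le_i.
have [le_im|lt_mi] := leqP i (a1 + a2 + a3).+1; last first.
  rewrite coefD !nth_default ?addr0 //; [exact: leq_trans sh _ | exact: leq_trans sf _].
have lt_i : (i - a2.+1 < (a1 + a3).+1)%N by lia.
have := congr1 (fun v : 'rV_(a1 + a3).+1 => v 0 (Ordinal lt_i)) Lu.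
by rewrite !mxE /= subnKC //; lia.
Qed.

(** A nonzero multiple must be long enough to contain the missing zeros. *)
Lemma pade_excess_gt F H e t1 t2 t3 G :
  coprime_pair F H -> G != 0 -> pade e t1 t2 t3 (G * F) (G * H) ->
  (hdeg F H + (t1 - mup 0 F) + (t2 - mu_inf F H) + (t3 - mup (-1) H) <= e)%N.
Proof.
case/andP=> nd _ G0; rewrite pade_mulE // => /and3P[h1 h2 h3].
have [G' GE] := mup_factor G0 h1 h2.
have : (0 < size G')%N by move: G0; rewrite GE mulXnX1n_neq0 size_poly_gt0.
move: h3; rewrite GE size_mul; last by rewrite -size_poly_eq0 size_XnX1n.
  by rewrite size_XnX1n; clear; size_lia.
by move: G0; rewrite GE mulXnX1n_neq0.
Qed.

(** The coprime generator of a pair with orders m - a_i in degree m is either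
    primitive with the same data or a pullback from a level q > 1; the latter
    would make the carry at q equal to 1. *)
Lemma even_carry_primitive a1 a2 a3 : even_carry3 p a1 a2 a3 ->
  exists F H, primitive_pair F H a1 a2 a3.
Proof.
move=> ec; have [f [h [nz pfh]]] := pade_neq0_exists a1 a2 a3.
have nd : nondeg f h by apply: pade_nondeg pfh nz; lia.
have [F [H [G [cp G0 fE hE]]]] := nondeg_factor nd.
rewrite fE hE in pfh; have le_e := pade_excess_gt cp G0 pfh.
have lt_m : (2 * hdeg F H < mup 0 F + mu_inf F H + mup (-1) H)%N.
  have := leq_add_subn (a2 + a3).+1 (mup 0 F).
  have := leq_add_subn (a1 + a3).+1 (mu_inf F H).
  have := leq_add_subn (a1 + a2).+1 (mup (-1) H); move: le_e; clear.
  by do 3 move: (_ - _)%N => ?; lia.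
have [j [F0 [H0 [b1 [b2 [b3 [FE HE pr]]]]]]] := descent_primitive char_k cp lt_m.
have [cp0 hd m0 mi m1] := pr; have nd0 := proj1 (andP cp0).
have [F00 H00 _] := and3P nd0.
move: le_e; rewrite FE HE mup_comp0 // mup_compN1 // mu_inf_comp // hdeg_comp //.
rewrite hd m0 mi m1; case: j {FE HE} => [|j].
  rewrite expn0 !mul1n => le_e; exists F0, H0.
  have [-> -> ->] : [/\ a1 = b1, a2 = b2 & a3 = b3].
    have := leq_add_subn (a2 + a3).+1 (b2 + b3).+1.
    have := leq_add_subn (a1 + a3).+1 (b1 + b3).+1.
    have := leq_add_subn (a1 + a2).+1 (b1 + b2).+1; move: le_e; clear.
    by do 3 move: (_ - _)%N => ?; move=> *; split; lia.
  by [].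
set q := (p ^ j.+1)%N => le_e; have q_gt1 : (1 < q)%N by apply: prime_expn_gt1.
have : (0 < cone_dim (a1 + a2 + a3).+1 ((a1 + a2 + a3).+1 - a1)
   ((a1 + a2 + a3).+1 - a2) ((a1 + a2 + a3).+1 - a3) q b1 b2 b3)%N.
  rewrite cone_dimE subn_gt0 ltnS; move: le_e; rewrite !(mulnSr, mulnDr).
  by have [-> -> ->] := subSn_sum3 a1 a2 a3.
case/(cone_dim_gt0_divn q_gt1) => e1 e2 e3 e4.
by have /even_carry3P/(_ j.+1 isT) := ec; move=> /(_ p_prime); rewrite -/q e1 e2 e3 e4.
Qed.

(** At the outermost odd carry the truncated triple is even-carry, hence comes
    from a primitive pair; its pullback lives in the same rank one space as the
    given pair, contradicting uniqueness. *)
Lemma primitive_even_carry F H a1 a2 a3 :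
  primitive_pair F H a1 a2 a3 -> even_carry3 p a1 a2 a3.
Proof.
move=> pr; apply/negPn/negP => /(odd_carry_max p_prime)[j j_gt0 /= [eqj ecj]].
have [F' [H' pr']] := even_carry_primitive ecj.
have cj := cone_dim_odd_carry (prime_expn_gt1 p_prime j_gt0) eqj.
have c0 : (0 < cone_dim (a1 + a2 + a3).+1 ((a1 + a2 + a3).+1 - a1)
   ((a1 + a2 + a3).+1 - a2) ((a1 + a2 + a3).+1 - a3) (p ^ 0) a1 a2 a3)%N.
  by rewrite /cone_dim expn0 !mul1n !subnn !addn0 subn_gt0.
have [|j0 _ _ _] := primitive_pair_uniq char_k pr pr' _ c0 cj.
  by have [-> -> ->] := subSn_sum3 a1 a2 a3; clear; lia.
by rewrite -j0 in j_gt0.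
Qed.

End EvenCarryCount.

(** * Dimension of the space of pairs *)

Section MainCount.

Variables (k : fieldType) (p : nat).
Hypothesis char_k : p \in [pchar k].
Implicit Types (f h g F G H : {poly k}).

Let p_prime : prime p := pcharf_prime char_k.

Definition even_carry_count (e t1 t2 t3 : nat) : nat :=
  \sum_(1 <= i < (trunc_log p e).+1)
    \sum_(a1 < e %/ p ^ i) \sum_(a2 < e %/ p ^ i)
      \sum_(a3 < e %/ p ^ i | (a1 + a2 + a3 + 1 == e %/ p ^ i)%N
          && even_carry3 p a1 a2 a3)
        cone_dim e t1 t2 t3 (p ^ i) a1 a2 a3.

Lemma sum_nat_only (I : eqType) (r : seq I) (P : pred I) (F : I -> nat) i :
  uniq r -> i \in r -> P i ->
  (forall j, P j -> (0 < F j)%N -> j = i) -> (\sum_(j <- r | P j) F j = F i)%N.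
Proof.
move=> ur ir Pi only; rewrite big_mkcond (bigD1_seq i) //= Pi.
rewrite big1 ?addn0 // => j ji; case: ifP => // Pj.
by apply/eqP; rewrite eqn0Ngt; apply: contra ji => /(only _ Pj) ->.
Qed.

(** Summing the bounds on the orders gives q m <= e < q (m + 1), so m is
    determined by e and q. *)
Lemma cone_dim_divn e t1 t2 t3 d q a1 a2 a3 :
  (e <= d)%N -> (t1 + t2 + t3 = d + e + 2)%N ->
  (0 < cone_dim e t1 t2 t3 q a1 a2 a3)%N -> (e %/ q = (a1 + a2 + a3).+1)%N.
Proof.
move=> le_ed tE; rewrite cone_dimE subn_gt0 ltnS => le_e; apply: divn_interval.
rewrite !(mulnSr, mulnDr); move: le_e.
have := leq_add_subn t1 (q * a2 + q * a3 + q).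
have := leq_add_subn t2 (q * a1 + q * a3 + q).
have := leq_add_subn t3 (q * a1 + q * a2 + q).
move: le_ed tE; clear; do 3 move: (_ - _)%N => ?.
by move=> *; apply/andP; split; lia.
Qed.

(** At most one summand is nonzero, by uniqueness of the primitive generator. *)
Lemma even_carry_count_term e t1 t2 t3 d i a1 a2 a3 :
  (e <= d)%N -> (t1 + t2 + t3 = d + e + 2)%N -> (0 < i)%N ->
  even_carry3 p a1 a2 a3 ->
  (0 < cone_dim e t1 t2 t3 (p ^ i) a1 a2 a3)%N ->
  even_carry_count e t1 t2 t3 = cone_dim e t1 t2 t3 (p ^ i) a1 a2 a3.
Proof.
move=> le_ed tE i_gt0 ec c0; have eE := cone_dim_divn le_ed tE c0.
have lt_e : (2 * e < t1 + t2 + t3)%N by rewrite tE; move: le_ed; clear; lia.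
have [F [H pr]] := even_carry_primitive char_k ec.
have only j b1 b2 b3 : even_carry3 p b1 b2 b3 ->
    (0 < cone_dim e t1 t2 t3 (p ^ j) b1 b2 b3)%N ->
    [/\ j = i, b1 = a1, b2 = a2 & b3 = a3].
  move=> ecb cb; have [F' [H' pr']] := even_carry_primitive char_k ecb.
  exact: primitive_pair_uniq pr' pr lt_e cb c0.
have [lt1 lt2 lt3] : [/\ a1 < e %/ p ^ i, a2 < e %/ p ^ i & a3 < e %/ p ^ i]%N.
  by rewrite eE; split; clear; lia.
have pos (I : finType) (P : pred I) (X : I -> nat) :
    (0 < \sum_(x | P x) X x)%N -> exists2 x, P x & (0 < X x)%N.
  rewrite lt0n sum_nat_seq_neq0 => /hasP[x _ /andP[Px X0]].
  by exists x; rewrite ?lt0n.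
rewrite /even_carry_count (@sum_nat_only _ _ _ _ i); last 1 first.
- move=> j _ /pos[b1 _ /pos[b2 _ /pos[b3 /andP[_ ecb]]]].
  by case/(only _ _ _ _ ecb).
- rewrite (@sum_nat_only _ _ _ _ (Ordinal lt1)) ?index_enum_uniq ?mem_index_enum //.
    rewrite (@sum_nat_only _ _ _ _ (Ordinal lt2)) ?index_enum_uniq ?mem_index_enum //.
      rewrite (@sum_nat_only _ _ _ _ (Ordinal lt3)) ?index_enum_uniq ?mem_index_enum //.
        by rewrite /= eE addn1 eqxx.
      by move=> b3 /andP[_ ecb] /(only _ _ _ _ ecb)[_ _ _ b3E]; apply: val_inj.
    move=> b2 _ /pos[b3 /andP[_ ecb] /(only _ _ _ _ ecb)[_ _ b2E _]].
    exact: val_inj.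
  move=> b1 _ /pos[b2 _ /pos[b3 /andP[_ ecb] /(only _ _ _ _ ecb)[_ b1E _ _]]].
  exact: val_inj.
- exact: iota_uniq.
- rewrite mem_index_iota i_gt0 ltnS trunc_log_max ?prime_gt1 //.
  by have := eE; case: leqP => // lt_e'; rewrite divn_small.
- by [].
Qed.

(** The factor G is free of length even_carry_count: if some summand is
    positive, the corresponding primitive pair generates all pairs; if none is,
    the generator of a hypothetical nonzero pair would descend to a primitive
    pair and give a positive summand. *)
Lemma pade_space e d t1 t2 t3 : (e <= d)%N -> (t1 + t2 + t3 = d + e + 2)%N ->
  (e < t1 + t2)%N -> (e < t1 + t3)%N -> (e < t2 + t3)%N ->
  exists F1 H1, F1 != 0 /\ forall f h, pade e t1 t2 t3 f h <->
    exists2 G : {poly k}, (size G <= even_carry_count e t1 t2 t3)%N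
      & f = G * F1 /\ h = G * H1.
Proof.
move=> le_ed tE e12 e13 e23.
have lt_e : (2 * e < t1 + t2 + t3)%N by rewrite tE; move: le_ed; clear; lia.
have [N0|] := posnP (even_carry_count e t1 t2 t3); last first.
  rewrite lt0n sum_nat_seq_neq0 => /hasP[i]; rewrite mem_index_iota => /andP[i_gt0 _] /=.
  rewrite sum_nat_seq_neq0 => /hasP[a1 _] /=.
  rewrite sum_nat_seq_neq0 => /hasP[a2 _] /=.
  rewrite sum_nat_seq_neq0 => /hasP[a3 _ /andP[/andP[_ ec]]].
  rewrite -lt0n => c0; rewrite (even_carry_count_term le_ed tE i_gt0 ec c0).
  have [F [H pr]] := even_carry_primitive char_k ec.
  exact: pade_primitive_space pr lt_e c0.
exists 1, 1; split=> [|f h]; first exact: oner_neq0.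
rewrite N0; split=> [pfh|[G]]; last first.
  rewrite size_poly_leq0 => /eqP -> [-> ->].
  by rewrite !mul0r /pade !dvdp0 add0r size_poly0.
have [nz|] := boolP ((f != 0) || (h != 0)); last first.
  rewrite negb_or !negbK => /andP[/eqP-> /eqP->].
  by exists 0; rewrite ?size_poly0 ?mul0r.
have nd := pade_nondeg e12 e13 e23 pfh nz.
have [F [H [G [cp G0 fE hE]]]] := nondeg_factor nd.
rewrite fE hE in pfh; have le_e := pade_excess_gt cp G0 pfh.
have lt_m : ((2 * hdeg F H).+1 < mup 0 F + mu_inf F H + mup (-1) H)%N.
  have := leq_add_subn t1 (mup 0 F); have := leq_add_subn t2 (mu_inf F H).
  have := leq_add_subn t3 (mup (-1) H); move: le_e tE le_ed; clear.
  by do 3 move: (_ - _)%N => ?; lia.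
have [j [F0 [H0 [a1 [a2 [a3 [FE HE pr]]]]]]] := descent_primitive char_k cp (ltnW lt_m).
have [cp0 hd m0 mi m1] := pr; have nd0 := proj1 (andP cp0).
have [F00 H00 _] := and3P nd0.
(* An excess of at least 2 cannot occur at level 1. *)
have j_gt0 : (0 < j)%N.
  case: j FE HE => // FE HE; move: lt_m.
  rewrite FE HE mup_comp0 // mup_compN1 // mu_inf_comp // hdeg_comp //.
  by rewrite hd m0 mi m1 expn0 !mul1n; clear; lia.
have c0 : (0 < cone_dim e t1 t2 t3 (p ^ j) a1 a2 a3)%N.
  move: le_e; rewrite FE HE mup_comp0 // mup_compN1 // mu_inf_comp // hdeg_comp //.
  by rewrite hd m0 mi m1 cone_dimE subn_gt0 ltnS !(mulnSr, mulnDr).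
have ec := primitive_even_carry char_k pr.
by have := c0; rewrite -(even_carry_count_term le_ed tE j_gt0 ec c0) N0.
Qed.

End MainCount.

(** * Division by z_1 + z_2 + z_3 *)

Section SyntheticDivision.

Variable k : fieldType.
Implicit Types (f g h r : {poly k}).

(** The value of z_3 on the line z_1 + z_2 + z_3 = 0, in the coordinates z_1 =
    X and z_2 = 1. *)
Definition negX1 : {poly k} := - ('X + 1).

Lemma dvd_negX1n f n : (negX1 ^+ n %| f) = (('X + 1) ^+ n %| f).
Proof.
rewrite /negX1 exprNn -signr_odd; case: (odd n); rewrite ?expr0 ?expr1.
  by rewrite mulN1r dvdpNl.
by rewrite mul1r.
Qed.

Lemma size_negX1n n : size (negX1 ^+ n) = n.+1.
Proof.
rewrite /negX1 exprNn -signr_odd; case: (odd n); rewrite ?expr0 ?expr1.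
  by rewrite mulN1r size_polyN size_X1n.
by rewrite mul1r size_X1n.
Qed.

Lemma negX1n_neq0 n : negX1 ^+ n != 0.
Proof. by rewrite -size_poly_eq0 size_negX1n. Qed.

Lemma size_XnX1n_monomial x y : size ('X^x * negX1 ^+ y) = (x + y).+1.
Proof.
by rewrite size_mul ?negX1n_neq0 ?expf_neq0 ?polyX_eq0 // size_polyXn size_negX1n addnS.
Qed.

(** The forms z_1^(m-j) z_3^j are a basis of the binary forms of degree m, also
    when the variables are z_1 and z_2 with z_3 = - z_1 - z_2. *)
Lemma homogeneous_expansion m g : (size g <= m.+1)%N ->
  exists2 t : nat -> k, (forall j, (m < j)%N -> t j = 0)
    & g = \sum_(j < m.+1) t j *: ('X^(m - j) * negX1 ^+ j).
Proof.
elim: m g => [|m IHm] g sg.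
  have /size1_polyC gE := sg; exists (fun j => if j is 0 then g`_0 else 0) => [[]//|].
  by rewrite big_ord_recl big_ord0 !expr0 mulr1 addr0 alg_polyC {1}gE.
pose g1 := g - (g.[0] * (-1) ^+ m.+1) *: negX1 ^+ m.+1.
have /factor_theorem[g2 g1E] : root g1 0.
  rewrite /root /g1 hornerD hornerN hornerZ horner_exp /negX1 hornerN hornerD.
  by rewrite hornerX hornerC add0r -mulrA -exprMn mulrNN mulr1 expr1n mulr1 subrr.
rewrite polyC0 subr0 in g1E.
have sg1 : (size g1 <= m.+2)%N.
  rewrite (leq_trans (size_polyD _ _)) // geq_max sg size_polyN.
  by rewrite (leq_trans (size_scale_leq _ _)) // size_negX1n.
have sg2 : (size g2 <= m.+1)%N.
  have [->|g20] := eqVneq g2 0; first by rewrite size_poly0.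
  by move: sg1; rewrite g1E size_mulX.
have [t t0 g2E] := IHm _ sg2.
exists (fun j => if (j <= m)%N then t j
                 else if j == m.+1 then g.[0] * (-1) ^+ m.+1 else 0).
  by move=> j lt_j; rewrite leqNgt (ltnW lt_j) /= gtn_eqF.
rewrite big_ord_recr /= ltnn eqxx subnn expr0 mul1r.
rewrite -[LHS](subrK ((g.[0] * (-1) ^+ m.+1) *: negX1 ^+ m.+1)) -/g1 g1E g2E.
congr (_ + _); rewrite mulr_suml; apply: eq_bigr => j _.
rewrite -ltnS ltn_ord -scalerAl mulrAC -exprSr subSn //.
by rewrite -ltnS ltn_ord.
Qed.

Lemma power_expansion m g : (size g <= m)%N ->
  exists2 s : nat -> k, (forall j, (m <= j)%N -> s j = 0)
    & g = \sum_(j < m) s j *: negX1 ^+ j.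
Proof.
move=> sg; have ZZ : negX1 \Po negX1 = 'X.
  by rewrite /negX1 raddfN /= comp_polyD comp_polyX comp_polyC opprD opprK addrK.
have sZ : size (g \Po negX1) = size g.
  by rewrite size_comp_poly2 // -[negX1]expr1 size_negX1n.
exists (fun j => (g \Po negX1)`_j) => [j le_j|].
  by rewrite nth_default // sZ (leq_trans sg).
have {1}-> : g = (g \Po negX1) \Po negX1 by rewrite -comp_polyA ZZ comp_polyXr.
rewrite comp_polyE sZ.
rewrite (big_ord_widen _ (fun j => (g \Po negX1)`_j *: negX1 ^+ j) sg).
rewrite big_mkcond /=; apply: eq_bigr => j _; case: ltnP => // le_j.
by rewrite nth_default ?sZ // scale0r.
Qed.

(** With phi j the coefficient of z_3^j in F_1 + F_2, and h the value of F_3,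
    the sequence r lists the coefficients of z_3^y in the quotient by z_1 + z_2
    + z_3.  The partial sum of the first y + 1 terms is divisible by the power
    y + 1 of z_3, because the tail is, and because h is divisible by the power
    c. *)
Lemma synthetic_division e a b c (s t : nat -> k) h :
  (e < a + b)%N ->
  (forall j, (e < a + j)%N -> s j = 0) -> (forall j, (e < b + j)%N -> t j = 0) ->
  let phi j := s j *: 'X^a + t j *: 'X^(e - b - j) in
  ('X + 1) ^+ c %| h -> \sum_(j < e.+1) phi j * negX1 ^+ j = - h ->
  exists r : nat -> {poly k},
    [/\ forall y, (y < c)%N ->
          ('X + 1) * r y + (if y is y'.+1 then r y' else 0) = phi y
      & forall y, (y < c)%N -> (size (r y) <= a)%N /\ (size (r y) <= e - y)%N].
Proof.
move=> ab s0 t0 phi ch sumE.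
pose S y : {poly k} := \sum_(j < y) phi j * negX1 ^+ j.
have phi0 j : (e < j)%N -> phi j = 0.
  by move=> lt_j; rewrite /phi s0 ?t0 ?scale0r ?addr0 // (leq_trans lt_j) ?leq_addl.
have S_e y : S (e.+1 + y)%N = - h.
  rewrite /S big_split_ord /= sumE [X in _ + X]big1 ?addr0 // => j _.
  by rewrite phi0 ?mul0r // ltnS leq_addr.
have S_dvd y : (y <= c)%N -> negX1 ^+ y %| S y.
  move=> le_yc; have := S_e y; rewrite addnC /S big_split_ord /=.
  move/(canRL (addrK _)) ->; rewrite dvdp_sub //.
    by rewrite dvdpNr dvd_negX1n (dvdp_trans _ ch) ?dvdp_exp2l.
  apply: (big_ind (fun f => negX1 ^+ y %| f)); first exact: dvdp0.
    by move=> f g; apply: dvdp_add.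
  by move=> j _; rewrite exprD mulrCA dvdp_mulr.
pose r y : {poly k} := - (S y.+1 %/ negX1 ^+ y.+1).
have rE y : (y < c)%N -> r y * negX1 ^+ y.+1 = - S y.+1.
  by move=> lt_y; rewrite mulNr divpK // S_dvd.
exists r; split=> y lt_y.
  apply: (mulIf (negX1n_neq0 y)).
  have e1 : ('X + 1) * r y * negX1 ^+ y = S y.+1.
    have -> : 'X + 1 = - negX1 by rewrite opprK.
    by rewrite -mulrA mulNr mulrCA -exprS rE ?opprK.
  have e2 : (if y is y'.+1 then r y' else 0) * negX1 ^+ y = - S y.
    case: y lt_y {e1} => [|y] lt_y; first by rewrite mul0r /S big_ord0 oppr0.
    by rewrite rE // ltnW.
  by rewrite mulrDl e1 e2 /S big_ord_recr /= addrAC subrr add0r.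
have [->|ry0] := eqVneq (r y) 0; first by rewrite size_poly0.
have sS : (size (S y.+1) <= a + y.+1)%N && (size (S y.+1) <= e.+1)%N.
  rewrite -leq_min /S; apply: (leq_trans (size_sum _ _ _)).
  apply/bigmax_leqP => j _; rewrite mulrDl -!scalerAl.
  have lt_j := ltn_ord j; rewrite (leq_trans (size_polyD _ _)) // geq_max.
  have small (u : k) x z : (u != 0 -> (x + z < minn (a + y.+1) e.+1)%N) ->
      (size (u *: ('X^x * negX1 ^+ z)) <= minn (a + y.+1) e.+1)%N.
    have [->|u0 lt_xz] := eqVneq u 0; first by rewrite scale0r size_poly0.
    by rewrite size_scale // size_XnX1n_monomial lt_xz.
  rewrite !small //; apply: contraNltn => le_m; apply/eqP.
    by apply: t0; move: le_m ab lt_j; clear; lia.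
  by apply: s0; move: le_m ab lt_j; clear; lia.
have sr : (size (r y) + y.+1 = size (S y.+1))%N.
  rewrite -[size (S _)]size_polyN -rE // size_mul ?negX1n_neq0 //.
  by rewrite size_negX1n !addnS.
case/andP: sS; rewrite -sr; move: (size (r y)); clear=> n; split; lia.
Qed.

End SyntheticDivision.

(** * Boundary polynomials of a kernel vector *)

Section Boundary.

Variables (k : fieldType) (d n : nat).

Lemma mons_addX_surj m (A : mons m.+1) (i : 'I_3) :
  (0 < mons_val A i)%N -> exists A', A = mons_addX A' i.
Proof.
move=> Ai; have le_iA : (U_(i) <= mons_val A)%MM.
  by apply/mnm_lepP => j; rewrite mnm1E; case: eqP => // <-.
have degA : mdeg (mons_val A - U_(i))%MM = m.
  by rewrite -[mdeg _](addnK (mdeg U_(i))) -mdegD submK // mons_valP mdeg1 subn1.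
exists (mk_mons degA); apply: mons_val_inj; rewrite /mons_addX /mons_val /= submK //.
Qed.

Lemma mons_addXE m (A : mons m) (i j : 'I_3) :
  mons_val (mons_addX A i) j = (mons_val A j + (i == j))%N.
Proof. by rewrite /mons_addX /mons_val /= mnmDE mnm1E. Qed.

Lemma mons_addX_inj m i : injective (fun A : mons m => mons_addX A i).
Proof.
move=> A B /(congr1 (fun C => mons_val C)) eqAB; apply: mons_val_inj.
apply/mnmP => j; apply: (@addIn (i == j)).
by rewrite -!mons_addXE eqAB.
Qed.

Lemma mons_sum3 m (A : mons m) :
  (mons_val A 0%R + mons_val A 1%R + mons_val A 2%R = m)%N.
Proof.
rewrite -[RHS](mons_valP A) mdegE !big_ord_recl big_ord0 addn0 addnA.
by congr (_ + _ + _)%N; congr (mons_val A _); apply: val_inj.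
Qed.

Lemma mem_ker_mu (v : DS k d.+1 n) : reflect
  (forall (A : mons d) (C : mons n.+1),
     \sum_(ib : 'I_3 * mons n | mons_addX ib.2 ib.1 == C)
        v (mons_addX A ib.1, ib.2) = 0)
  (v \in lker (mu_map k d n)).
Proof.
rewrite memv_ker; apply: (iffP eqP) => [v0 A C|h].
  have := congr1 (fun w : DS k d n.+1 => w (A, C)) v0.
  rewrite /mu_map comp_lfunE !lfunE /= !ffunE /=.
  by apply: etrans; apply: eq_bigr => ib _; rewrite !ffunE.
apply/ffunP => -[A C]; rewrite /mu_map comp_lfunE !lfunE /= !ffunE /=.
by rewrite -[RHS](h A C); apply: eq_bigr => ib _; rewrite !ffunE.
Qed.

(** The kernel equation expresses v (A, B) through the values at which the i-th
    exponent of A is smaller by one. *)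
Lemma ker_mu_eq0 (i : 'I_3) (v : DS k d.+1 n) : v \in lker (mu_map k d n) ->
  (forall A B, mons_val A i = 0%N -> v (A, B) = 0) -> v = 0.
Proof.
move=> /mem_ker_mu kv v0; apply/ffunP => -[A B]; rewrite [RHS]ffunE.
move: {2}(mons_val A i) (leqnn (mons_val A i)) => m.
elim: m A B => [|m IHm] A B; first by rewrite leqn0 => /eqP /v0.
move=> le_m; have [/eqP|Ai] := posnP (mons_val A i); first by move/eqP/v0.
have [A' AE] := mons_addX_surj Ai; have := kv A' (mons_addX B i).
rewrite (bigD1 (i, B)) //= -AE big1 ?addr0 // => -[j C] /= /andP[/eqP eqC neC].
have neij : i != j.
  by apply: contraNneq neC => ij; move: eqC; rewrite -ij => /mons_addX_inj ->.
apply: IHm; move: le_m; rewrite AE !mons_addXE eqxx eq_sym (negPf neij) addn0.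
by rewrite addn1.
Qed.

(** Restriction of a monomial to the line z_1 + z_2 + z_3 = 0, at z_1 = X and
    z_2 = 1. *)
Definition mons_eval m (B : mons m) : {poly k} :=
  'X^(mons_val B 0) * negX1 k ^+ mons_val B 2.

(** Restriction to the line of F_i, the part of (z_1 + z_2 + z_3) r whose
    monomials have left the box on the i-th side; r is read off from the
    S-factor of v. *)
Definition boundary (i : 'I_3) (v : DS k d.+1 n) : {poly k} :=
  \sum_(c | mons_val c.1 i == 0%N) (v c : k) *: mons_eval (mons_addX c.2 i).

Lemma sum_ord3 (V : nmodType) (F : 'I_3 -> V) : \sum_i F i = F 0 + F 1 + F 2.
Proof.
rewrite !big_ord_recl big_ord0 addr0 addrA.
by congr (_ + _ + _); congr F; apply: val_inj.
Qed.

(** The total of all terms is the restriction of a multiple of z_1 + z_2 + z_3,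
    hence zero, and the terms that stay inside the box cancel by the kernel
    equation. *)
Lemma boundary_sum0 (v : DS k d.+1 n) : v \in lker (mu_map k d n) ->
  boundary 0 v + boundary 1 v + boundary 2 v = 0.
Proof.
move=> /mem_ker_mu kv.
have ev0 m (B : mons m) : \sum_i mons_eval (mons_addX B i) = 0.
  rewrite sum_ord3 /mons_eval !mons_addXE /= !addn0 !addn1 !exprS /negX1; ring.
rewrite -(sum_ord3 (fun i => boundary i v)).
have tot : \sum_i \sum_c (v c : k) *: mons_eval (mons_addX c.2 i) = 0.
  by rewrite exchange_big big1 // => c _; rewrite -scaler_sumr ev0 scaler0.
have interior i :
    \sum_(c | mons_val c.1 i != 0%N) (v c : k) *: mons_eval (mons_addX c.2 i)
    = \sum_(A : mons d) \sum_(C : mons n.+1) \sum_(B | mons_addX B i == C)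
        (v (mons_addX A i, B) : k) *: mons_eval C.
  pose ad (x : mons d * mons n) := (mons_addX x.1 i, x.2).
  have ad_inj : injective ad.
    move=> [A B] [A' B'] /eqP; rewrite /ad /= xpair_eqE.
    by move=> /andP[/eqP/mons_addX_inj -> /eqP ->].
  rewrite (eq_bigl (mem (ad @: setT))) => [|[A B]] /=; last first.
    apply/idP/imsetP => [|[[A' B'] _ [AE _]]]; last first.
      have -> : A = mons_addX A' i.
        by apply: mons_val_inj; apply/mnmP => j; rewrite /mons_val /= AE.
      by rewrite mons_addXE eqxx addn1.
    by rewrite -lt0n => /mons_addX_surj[A' ->]; exists (A', B).
  rewrite big_imset /=; last by move=> x y _ _ /ad_inj.
  rewrite (eq_bigl xpredT) => [|x]; last by rewrite inE.
  rewrite -(pair_bigA _ (fun A B =>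
    (v (mons_addX A i, B) : k) *: mons_eval (mons_addX B i))) /=.
  apply: eq_bigr => A _; rewrite (partition_big (fun B => mons_addX B i) xpredT) //=.
  by apply: eq_bigr => C _; apply: eq_bigr => B /eqP ->.
have : \sum_i \sum_(c | mons_val c.1 i != 0%N)
    (v c : k) *: mons_eval (mons_addX c.2 i) = 0.
  rewrite (eq_bigr _ (fun i _ => interior i)) exchange_big big1 // => A _ /=.
  rewrite exchange_big big1 // => C _ /=.
  transitivity ((\sum_(ib : 'I_3 * mons n | mons_addX ib.2 ib.1 == C)
     v (mons_addX A ib.1, ib.2) : k) *: mons_eval C); last by rewrite kv scale0r.
  by rewrite scaler_suml pair_big_dep.
move: tot; rewrite /boundary.
rewrite (eq_bigr _ (fun i _ => bigID (fun c => mons_val c.1 i == 0%N) _ _)) /=.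
by rewrite big_split /= => tot int0; move: tot; rewrite int0 addr0.
Qed.

End Boundary.

(** * Weight spaces of the kernel *)

Section WeightSpace.

Variables (k : fieldType) (d n : nat) (al : mons (d.+1 + n)).
Implicit Types (c : mons d.+1 * mons n) (v : DS k d.+1 n) (f h : {poly k}).

Local Notation al_ i := (mons_val al i%R).
Local Notation U := (lker (mu_map k d n) :&: weight_space k al)%VS.
Local Notation pade_al := (pade n.+1 (al_ 0).+1 (al_ 1).+1 (al_ 2).+1).

Lemma weightE c i : mons_val (weight c) i = (mons_val c.1 i + mons_val c.2 i)%N.
Proof. by rewrite /weight /mons_add /mons_val /= mnmDE. Qed.

Lemma size_mons_eval m (B : mons m) :
  size (mons_eval k B) = (mons_val B 0%R + mons_val B 2%R).+1.
Proof. exact: size_XnX1n_monomial. Qed.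

Lemma weight_boundary v c i : v \in weight_space k al -> mons_val c.1 i = 0%N ->
  v c != 0 -> mons_val c.2 i = al_ i.
Proof. by move=> /mem_weight_space wv c0 /wv <-; rewrite weightE c0. Qed.

Lemma size_boundary i v : (size (boundary i v) <= n.+2)%N.
Proof.
rewrite /boundary (leq_trans (size_sum _ _ _)) //; apply/bigmax_leqP => c _.
rewrite (leq_trans (size_scale_leq _ _)) // size_mons_eval ltnS.
by have := mons_sum3 (mons_addX c.2 i); lia.
Qed.

Lemma boundary_pade v : v \in U -> pade_al (boundary 0 v) (boundary 2 v).
Proof.
rewrite memv_cap => /andP[kv wv]; have sum0 := boundary_sum0 kv.
have dvd i l : (forall c, mons_val c.1 i = 0%N -> v c != 0 ->
    l %| mons_eval k (mons_addX c.2 i)) -> l %| boundary i v.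
  move=> dl; apply: (big_ind (fun g => l %| g)); first exact: dvdp0.
    by move=> *; apply: dvdp_add.
  move=> c /eqP c0; have [->|vc0] := eqVneq (v c) 0; first by rewrite scale0r dvdp0.
  by rewrite dvdpZr // dl.
apply/and5P; split; rewrite ?size_boundary //.
- apply: dvd => c c0 vc0; rewrite /mons_eval mons_addXE (weight_boundary wv c0 vc0).
  by rewrite addn1 dvdp_mulr.
- apply: dvd => c c0 vc0; rewrite /mons_eval !mons_addXE (weight_boundary wv c0 vc0).
  by rewrite eqxx addn1 -dvd_negX1n dvdp_mull.
have -> : boundary 0 v + boundary 2 v = - boundary 1 v.
  by apply/eqP; rewrite -addr_eq0 addrAC sum0.
rewrite size_polyN (leq_trans (size_sum _ _ _)) //; apply/bigmax_leqP => c /eqP c0.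
have [->|vc0] := eqVneq (v c) 0; first by rewrite scale0r size_poly0.
rewrite (leq_trans (size_scale_leq _ _)) // size_mons_eval !mons_addXE !addn0.
rewrite -(weight_boundary wv c0 vc0); have := mons_sum3 c.2; clear.
by move: (mons_val c.2 0%R) (mons_val c.2 1%R) (mons_val c.2 2%R) => x y z; lia.
Qed.

Lemma ord3_ind (P : 'I_3 -> Prop) : P 0 -> P 1 -> P 2 -> forall i, P i.
Proof.
move=> P0 P1 P2 [[|[|[|//]]] lti].
- by rewrite (_ : Ordinal lti = 0) //; apply: val_inj.
- by rewrite (_ : Ordinal lti = 1) //; apply: val_inj.
- by rewrite (_ : Ordinal lti = 2) //; apply: val_inj.
Qed.

(** On the face of the box where the first exponent of the D-factor is zero, a
    monomial of given weight is determined by its z_3-exponent. *)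
Lemma layer_inj c c' : weight c = weight c' -> mons_val c.1 0%R = 0%N ->
  mons_val c'.1 0%R = 0%N -> mons_val c.2 2%R = mons_val c'.2 2%R -> c = c'.
Proof.
move=> wc c0 c0' c2.
have w i := congr1 (fun A => mons_val A i) wc; move: w => /= w.
have := w 0; have := w 1; have := w 2; rewrite !weightE.
have := mons_sum3 c.2; have := mons_sum3 c'.2.
case: c c' c0 c0' c2 {wc w} => [A B] [A' B'] /= *.
congr (_, _); apply: mons_val_inj; apply/mnmP; apply: ord3_ind; lia.
Qed.

(** The powers of z_3 are linearly independent on the line, so a zero boundary
    on one face makes v vanish on that face, hence everywhere by the recursion
    of the kernel equation. *)
Lemma boundary_inj v : v \in U -> boundary 0 v = 0 -> v = 0.
Proof.
rewrite memv_cap => /andP[kv wv] b0; apply: (ker_mu_eq0 (i := 0) kv) => A B A0.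
apply/eqP/negPn/negP => vAB.
have wAB : weight (A, B) = al by move/mem_weight_space: wv; apply.
pose g : {poly k} :=
  \sum_(c | mons_val c.1 0%R == 0%N) (v c : k) *: 'X^(mons_val c.2 2%R).
have g0 : g = 0.
  apply/eqP; rewrite -(comp_poly2_eq0 g (q := negX1 k)); last first.
    by rewrite -[negX1 k]expr1 size_negX1n.
  have X0 : 'X^((al_ 0).+1) != 0 :> {poly k} by rewrite expf_neq0 ?polyX_eq0.
  apply/eqP; apply: (mulfI X0).
  rewrite mulr0 -b0 /g rmorph_sum mulr_sumr; apply: eq_bigr => c /eqP c0 /=.
  rewrite comp_polyZ comp_Xn_poly -scalerAr.
  have [->|vc0] := eqVneq (v c) 0; first by rewrite !scale0r.
  by rewrite /mons_eval !mons_addXE (weight_boundary wv c0 vc0) eqxx addn1 addn0.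
have := congr1 (fun q : {poly k} => q`_(mons_val B 2%R)) g0.
rewrite coef0 coef_sum (bigD1 (A, B)) /= ?A0 // big1 => [|c /andP[/eqP c0 neq]].
  by rewrite addr0 coefZ coefXn eqxx mulr1 => /eqP; rewrite (negPf vAB).
rewrite coefZ coefXn; case: eqP => [eqB|]; last by rewrite mulr0.
have [->|vc0] := eqVneq (v c) 0; first by rewrite mul0r.
have wc : weight c = al by move/mem_weight_space: wv; apply.
by rewrite (@layer_inj c (A, B)) ?eqxx ?wc ?wAB in neq.
Qed.

Lemma mons3_exists m x y z : (x + y + z = m)%N ->
  exists A : mons m, [/\ mons_val A 0%R = x, mons_val A 1%R = y & mons_val A 2%R = z].
Proof.
move=> eqm; pose B := [multinom [tuple x; y; z]] : 'X_{1..3}.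
have degB : mdeg B = m by rewrite mdegE !big_ord_recl big_ord0 addn0 addnA -eqm.
by exists (mk_mons degB).
Qed.

Lemma layer_sum (V : nmodType) (F : nat -> V) :
  (n < al_ 0 + al_ 1 + 1)%N -> (n < al_ 0 + al_ 2 + 1)%N ->
  (forall j, (n < al_ 0 + j)%N -> F j = 0) ->
  \sum_(c | (mons_val c.1 0%R == 0%N) && (weight c == al)) F (mons_val c.2 2%R)
    = \sum_(j < n.+2) F j.
Proof.
move=> lt01 lt02 F0; have c2_lt c : (mons_val c.2 2%R < n.+2)%N.
  by have := mons_sum3 c.2; lia.
rewrite (partition_big (fun c => Ordinal (c2_lt c)) xpredT) //=.
apply: eq_bigr => j _; have [le_j|lt_j] := leqP (al_ 0 + j)%N n; last first.
  rewrite F0 //; apply: big1 => c /andP[/andP[/eqP c0 /eqP wc] /eqP/(congr1 val) /= cj].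
  by rewrite F0 // cj.
have alS := mons_sum3 al.
have [B [B0 B1 B2]] : exists B : mons n, [/\ mons_val B 0%R = al_ 0,
    mons_val B 1%R = (n - al_ 0 - j)%N & mons_val B 2%R = j].
  by apply: mons3_exists; lia.
have [A [A0 A1 A2]] : exists A : mons d.+1, [/\ mons_val A 0%R = 0%N,
    mons_val A 1%R = (al_ 1 - (n - al_ 0 - j))%N & mons_val A 2%R = (al_ 2 - j)%N].
  by apply: mons3_exists; lia.
have wAB : weight (A, B) = al.
  apply: mons_val_inj; apply/mnmP; apply: ord3_ind;
    rewrite weightE /= ?A0 ?B0 ?A1 ?B1 ?A2 ?B2; lia.
rewrite (big_pred1 (A, B)) /= ?B2 // => c /=; apply/idP/eqP => [|->]; last first.
  by rewrite A0 wAB !eqxx /=; apply/eqP/val_inj.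
case/andP=> /andP[/eqP c0 /eqP wc] /eqP/(congr1 val) /= cj.
by apply: layer_inj; rewrite ?wc ?wAB ?c0 ?cj.
Qed.

(** Given (f, h), expand f and - (f + h) along the monomials of the first two
    faces; the rows r y of the synthetic division are the values of the
    required vector, and their recursion is the kernel equation inside the box. *)
Lemma boundary_surj f h :
  (n < al_ 0 + al_ 1 + 1)%N -> (n < al_ 0 + al_ 2 + 1)%N ->
  pade_al f h -> exists2 v, v \in U & boundary 0 v = f.
Proof.
move=> lt01 lt02 /and5P[fa hc sf sh sg].
have [s s0 fE] : exists2 s : nat -> k, (forall j, (n.+1 < (al_ 0).+1 + j)%N -> s j = 0)
    & f = 'X^((al_ 0).+1) * \sum_(j < n.+2) s j *: negX1 k ^+ j.
  have /dvdpP[A AE] := fa; have [|s s0 As] := @power_expansion k (n.+1 - al_ 0)%N A.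
    have [->|A0] := eqVneq A 0; first by rewrite size_poly0.
    by move: sf; rewrite AE size_mulXn //; clear; size_lia.
  exists s => [j lt_j|]; first by apply: s0; lia.
  rewrite AE mulrC; congr (_ * _); rewrite {1}As.
  rewrite (big_ord_widen n.+2 (fun j => s j *: negX1 k ^+ j)); last by lia.
  rewrite big_mkcond; apply: eq_bigr => j _; case: ltnP => // /s0 ->.
  by rewrite scale0r.
have [t t0 gE] : exists2 t : nat -> k, (forall j, (n.+1 < (al_ 1).+1 + j)%N -> t j = 0)
    & - (f + h) = \sum_(j < n.+2) t j *: ('X^(n.+1 - (al_ 1).+1 - j) * negX1 k ^+ j).
  have [le_bn|lt_nb] := leqP (al_ 1) n; last first.
    exists (fun=> 0) => //; rewrite big1 => [|j _]; last by rewrite scale0r.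
    apply/eqP; rewrite oppr_eq0 -size_poly_leq0 (leq_trans sg) //; lia.
  have [|t t0 gE] := @homogeneous_expansion k (n.+1 - (al_ 1).+1)%N (- (f + h)).
    by rewrite size_polyN (leq_trans sg) //; lia.
  exists t => [j lt_j|]; first by apply: t0; lia.
  rewrite gE (big_ord_widen n.+2
    (fun j => t j *: ('X^(n.+1 - (al_ 1).+1 - j) * negX1 k ^+ j))); last by lia.
  rewrite big_mkcond; apply: eq_bigr => j _; case: ltnP => // /t0 ->.
  by rewrite scale0r.
have ab : (n.+1 < (al_ 0).+1 + (al_ 1).+1)%N by lia.
pose phi j := s j *: 'X^((al_ 0).+1) + t j *: 'X^(n.+1 - (al_ 1).+1 - j) : {poly k}.
have sumE : \sum_(j < n.+2) phi j * negX1 k ^+ j = - h.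
  rewrite (_ : - h = f + - (f + h)); last by rewrite opprD addrA subrr add0r.
  rewrite gE {1}fE mulr_sumr -big_split; apply: eq_bigr => j _ /=.
  by rewrite /phi mulrDl -!scalerAl scalerAr.
have [r [rE rsz]] := synthetic_division ab s0 t0 hc sumE.
pose R x y := (r y)`_x.
(* The coefficient of X^x in row y of the recursion; inside the box the
   contributions s y and t y of the two faces are absent. *)
have R_row x y z : (x <= al_ 0)%N -> (z <= al_ 1)%N -> (y <= al_ 2)%N ->
    (x + z + y = n.+1)%N ->
    (if (0 < x)%N then R x.-1 y else 0) + (if (0 < z)%N then R x y else 0)
      + (if (0 < y)%N then R x y.-1 else 0) = 0.
  move=> le_x le_z le_y xyz; have := congr1 (fun q : {poly k} => q`_x) (rE y le_y).
  rewrite /phi mulrDl mul1r !coefD !coefZ !coefXn coefXM.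
  rewrite [(x == (al_ 0).+1)]ltn_eqF ?ltnS // mulr0 add0r.
  have -> : t y * (x == n.+1 - (al_ 1).+1 - y)%N%:R = 0.
    case: eqP => xE; last by rewrite mulr0.
    by rewrite t0 ?mul0r //; lia.
  move=> eq0; rewrite -[RHS]eq0; congr (_ + _ + _); first by case: (x).
    case: posnP => // z0; rewrite nth_default //.
    by have [_] := rsz y le_y; move=> /leq_trans; apply; lia.
  by case: (y) => //=; rewrite coef0.
pose v : DS k d.+1 n := [ffun c : mons d.+1 * mons n =>
  if weight c == al then R (mons_val c.2 0%R) (mons_val c.2 2%R) else 0].
have kv : v \in lker (mu_map k d n).
  apply/mem_ker_mu => A C.
  rewrite -(pair_big_dep xpredT (fun i B => mons_addX B i == C)
              (fun i B => v (mons_addX A i, B))) /=.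
  have inner (i : 'I_3) (K : k) :
      (forall B, mons_addX B i = C -> v (mons_addX A i, B) = K) ->
      \sum_(B | mons_addX B i == C) (v (mons_addX A i, B) : k)
        = if (0 < mons_val C i)%N then K else 0.
    move=> vK; case: posnP => [C0|/mons_addX_surj[B0 CE]].
      rewrite big_pred0 // => B; apply/eqP => eqC.
      by move: C0; rewrite -eqC mons_addXE eqxx addn1.
    rewrite (big_pred1 B0) ?vK // => B; rewrite CE.
    by apply/eqP/eqP => [/mons_addX_inj|->].
  have [/eqfunP wAC|nw] :=
    boolP [forall i, (mons_val A i + mons_val C i == al_ i)%N]; last first.
    rewrite big1 // => i _; rewrite (inner i 0); first by case: ifP.
    move=> B BC; rewrite ffunE; case: eqP => // wE; case/forallP: nw => j.
    by rewrite -wE weightE -BC !mons_addXE /= -!addnA eqn_add2l addnC.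
  have wE i B : mons_addX B i = C -> weight (mons_addX A i, B) = al.
    move=> BC; apply: mons_val_inj; apply/mnmP => j; rewrite weightE -wAC -BC.
    by rewrite !mons_addXE /= -!addnA; congr (_ + _)%N; rewrite addnC.
  rewrite sum_ord3 (inner 0 (R (mons_val C 0%R).-1 (mons_val C 2%R))); last first.
    by move=> B BC; rewrite ffunE wE // eqxx -BC !mons_addXE /= addn1 addn0.
  rewrite (inner 1 (R (mons_val C 0%R) (mons_val C 2%R))); last first.
    by move=> B BC; rewrite ffunE wE // eqxx -BC !mons_addXE /= !addn0.
  rewrite (inner 2 (R (mons_val C 0%R) (mons_val C 2%R).-1)); last first.
    by move=> B BC; rewrite ffunE wE // eqxx -BC !mons_addXE /= addn1 addn0.
  apply: R_row; rewrite -?wAC ?leq_addl //; exact: mons_sum3.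
exists v.
  rewrite memv_cap kv; apply/mem_weight_space => c; rewrite ffunE.
  by case: (weight c =P al) => // _ /eqP.
rewrite /boundary (bigID (fun c => weight c == al)) /= [X in _ + X]big1 ?addr0; last first.
  by move=> c /andP[_ nw]; rewrite ffunE (negPf nw) scale0r.
rewrite fE -(layer_sum (F := fun j => s j *: negX1 k ^+ j)) //; last first.
  by move=> j lt_j; rewrite s0 ?scale0r // addSn ltnS.
rewrite mulr_sumr; apply: eq_bigr => c /andP[/eqP c0 /eqP wc].
have c2 i : (mons_val c.1 i + mons_val c.2 i = al_ i)%N by rewrite -wc weightE.
have c20 : mons_val c.2 0%R = al_ 0 by rewrite -c2 c0.
rewrite ffunE wc eqxx /mons_eval !mons_addXE c20 eqxx addn1 addn0 -scalerAr.
congr (_ *: _); have le_c : (mons_val c.2 2%R <= al_ 2)%N by rewrite -c2 leq_addl.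
(* On the face itself the same recursion returns the coefficient s. *)
have := congr1 (fun q : {poly k} => q`_((al_ 0).+1)) (rE _ le_c).
rewrite /phi mulrDl mul1r !coefD !coefZ !coefXn coefXM /= eqxx mulr1.
have [sz _] := rsz _ le_c; rewrite [(r (mons_val c.2 2%R))`_(al_ 0).+1]nth_default //.
rewrite addr0.
have -> : t (mons_val c.2 2%R)
    * ((al_ 0).+1 == n.+1 - (al_ 1).+1 - mons_val c.2 2%R)%N%:R = 0.
  case: eqP => xE; last by rewrite mulr0.
  by move: xE lt01; clear; lia.
rewrite addr0 => <-; rewrite -[LHS]addr0; congr (_ + _).
have : ((mons_val c.2 2%R).-1 < (al_ 2).+1)%N by move: le_c; clear; lia.
case: (mons_val c.2 2%R) => [|y] /= lt_y; first by rewrite coef0.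
by have [sz' _] := rsz _ lt_y; rewrite nth_default.
Qed.

End WeightSpace.

(** * Multiplicity of a weight *)

Section Dimension.

Variable k : fieldType.

Lemma dimv_poly_multiples (vT : vectType k) (U : {vspace vT})
    (L : {linear vT -> {poly k}}) (F : {poly k}) (N : nat) : F != 0 ->
  (forall v, v \in U -> L v = 0 -> v = 0) ->
  (forall f, (exists2 v, v \in U & L v = f) <->
             (exists2 G : {poly k}, (size G <= N)%N & f = G * F)) ->
  \dim U = N.
Proof.
move=> F0 L_inj L_im; pose T v : 'rV[k]_N := poly_rV (L v %/ F).
have T_lin : linear T.
  by move=> c u v; rewrite /T linearP divpD divpZl linearP.
pose Tl : {linear _ -> _} := HB.pack T (GRing.isLinear.Build k _ _ _ T T_lin).
have L_div v : v \in U -> exists2 G : {poly k}, (size G <= N)%N & L v = G * F.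
  by move=> vU; apply/L_im; exists v.
have kerT : (U :&: lker (linfun Tl) = 0)%VS.
  apply/eqP; rewrite -subv0; apply/subvP => v; rewrite memv_cap memv0 memv_ker.
  rewrite lfunE => /andP[vU /eqP Tv]; apply/eqP/L_inj => //.
  have [G sG LvE] := L_div v vU; move: Tv; rewrite /= /T LvE mulpK // => G0.
  by rewrite -(poly_rV_K sG) G0 linear0 mul0r.
have imT : (linfun Tl @: U = fullv)%VS.
  apply/eqP; rewrite eqEsubv subvf; apply/subvP => w _; apply/memv_imgP.
  have [|v vU LvE] := (L_im (rVpoly w * F)).2.
    by exists (rVpoly w) => //; apply: size_poly.
  by exists v => //; rewrite lfunE /= /T LvE mulpK // rVpolyK.
by rewrite -(limg_dim_eq kerT) imT dimvf dim_matrix mul1r.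
Qed.

Lemma mons_leq m (B : mons m) i : (mons_val B i <= m)%N.
Proof. by have := mons_sum3 B; move: i; apply: ord3_ind; lia. Qed.

Lemma boundary_linear (d n : nat) (i : 'I_3) : linear (@boundary k d n i).
Proof.
move=> c u v; rewrite /boundary scaler_sumr -big_split /=.
by apply: eq_bigr => b _; rewrite !ffunE scalerA -scalerDl.
Qed.

Variable p : nat.
Hypothesis char_k : p \in [pchar k].

(** When all exponents of the weight are at most d + 1 the three orders add up
    pairwise to more than the degree and pade_space applies; otherwise kernel
    vectors vanish on a whole face, and no pullback fits. *)
Theorem dim_ker_weight_space (d n : nat) (al : mons (d.+1 + n)) : (n <= d)%N ->
  \dim (lker (mu_map k d n) :&: weight_space k al)%VS =
    even_carry_count p n.+1 (mons_val al 0).+1 (mons_val al 1).+1 (mons_val al 2).+1.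
Proof.
move=> le_nd; have alS := mons_sum3 al.
have tE : ((mons_val al 0%R).+1 + (mons_val al 1%R).+1 + (mons_val al 2%R).+1
   = d.+1 + n.+1 + 2)%N by lia.
have [/forallP le_al|] := boolP [forall i : 'I_3, mons_val al i <= d.+1]%N; last first.
  rewrite negb_forall => /existsP[i]; rewrite -ltnNge => lt_i.
  transitivity 0%N.
    apply/eqP; rewrite dimv_eq0 -subv0; apply/subvP => v; rewrite memv_cap memv0.
    case/andP=> kv /mem_weight_space wv; apply/eqP/(ker_mu_eq0 (i := i) kv) => A B A0.
    apply/eqP/negPn/negP => /wv wAB; move: lt_i; rewrite -wAB weightE A0 add0n.
    by rewrite ltnNge (leq_trans (mons_leq B i)) // ltnW.
  symmetry; apply/eqP; rewrite /even_carry_count sum_nat_seq_eq0.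
  apply/allP => j _; rewrite sum_nat_seq_eq0; apply/allP => a1 _.
  rewrite sum_nat_seq_eq0; apply/allP => a2 _; rewrite sum_nat_seq_eq0.
  apply/allP => a3 _; apply/implyP => _; rewrite cone_dimE subn_eq0.
  move: lt_i; move: (i); apply: ord3_ind; lia.
have le0 := le_al 0; have le1 := le_al 1; have le2 := le_al 2.
have [e12 e13 e23] : [/\ n.+1 < (mons_val al 0%R).+1 + (mons_val al 1%R).+1,
    n.+1 < (mons_val al 0%R).+1 + (mons_val al 2%R).+1
  & n.+1 < (mons_val al 1%R).+1 + (mons_val al 2%R).+1]%N.
  move: le0 le1 le2 alS; move: (mons_val al 0) (mons_val al 1) (mons_val al 2).
  by clear; split; lia.
have [F1 [H1 [F10 spn]]] := pade_space char_k (le_nd : n.+1 <= d.+1)%N tE e12 e13 e23.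
pose Bl : {linear _ -> _} := HB.pack (@boundary k d n 0)
   (GRing.isLinear.Build k _ _ _ _ (@boundary_linear d n 0)).
apply: (dimv_poly_multiples (L := Bl) F10) => [v|f]; first exact: boundary_inj.
split=> [[v vU <-]|[G sG ->]].
  by have /spn[G sG [bE _]] := boundary_pade vU; exists G.
have /boundary_surj[||v vU vE] : pade n.+1 (mons_val al 0).+1 (mons_val al 1).+1
   (mons_val al 2).+1 (G * F1) (G * H1) by apply/spn; exists G.
- by move: e12; move: (mons_val al 0) (mons_val al 1); clear; lia.
- by move: e13; move: (mons_val al 0) (mons_val al 2); clear; lia.
by exists v.
Qed.

End Dimension.

(** * Schur polynomials of two-row shapes in three variables *)

Section Schur.

Definition letters (n0 n1 n2 : nat) : seq 'I_3 :=
  nseq n0 (0 : 'I_3) ++ nseq n1 (1 : 'I_3) ++ nseq n2 (2 : 'I_3).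

Local Notation le3 := (fun i j : 'I_3 => i <= j)%N.

Lemma size_letters n0 n1 n2 : size (letters n0 n1 n2) = (n0 + n1 + n2)%N.
Proof. by rewrite !size_cat !size_nseq addnA. Qed.

Lemma count_letters n0 n1 n2 :
  [/\ count_mem (0 : 'I_3) (letters n0 n1 n2) = n0,
      count_mem (1 : 'I_3) (letters n0 n1 n2) = n1
    & count_mem (2 : 'I_3) (letters n0 n1 n2) = n2].
Proof.
by rewrite !count_cat !count_nseq /= !mul0n !mul1n !addn0 !add0n.
Qed.

Lemma nth_letters n0 n1 n2 i : (i < n0 + n1 + n2)%N ->
  nth 0 (letters n0 n1 n2) i =
    (if (i < n0)%N then 0 else if (i < n0 + n1)%N then 1 else 2)%N :> nat.
Proof.
move=> lt_i; rewrite /letters !nth_cat !size_nseq; case: ltnP => [lt0|le0].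
  by rewrite nth_nseq lt0.
rewrite ltn_subLR //; case: ltnP => [lt1|le1]; rewrite nth_nseq.
  by rewrite ltn_subLR // lt1.
by rewrite (_ : (i - n0 - n1 < n2)%N) //; lia.
Qed.

Lemma sorted_letters n0 n1 n2 : sorted le3 (letters n0 n1 n2).
Proof.
apply/(sortedP 0) => i; rewrite size_letters => lt_i.
rewrite !nth_letters //; last exact: ltnW.
by do 4?case: ifP; lia.
Qed.

Lemma sorted_letters_eq (s : seq 'I_3) : sorted le3 s ->
  s = letters (count_mem (0 : 'I_3) s) (count_mem (1 : 'I_3) s)
              (count_mem (2 : 'I_3) s).
Proof.
move=> s_sorted; apply: (@sorted_eq _ le3) => //.
- by move=> y x z; apply: leq_trans.
- by move=> x y; rewrite -eqn_leq => /eqP/val_inj.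
- exact: sorted_letters.
apply/allP => x _ /=; move: x.
have [c0 c1 c2] := count_letters (count_mem (0 : 'I_3) s) (count_mem (1 : 'I_3) s)
                     (count_mem (2 : 'I_3) s).
by apply: ord3_ind; rewrite ?c0 ?c1 ?c2.
Qed.

Lemma count_sum3 (s : seq 'I_3) :
  (count_mem (0%R : 'I_3) s + count_mem (1%R : 'I_3) s
    + count_mem (2%R : 'I_3) s = size s)%N.
Proof.
elim: s => //= x s <-; move: x; apply: ord3_ind => /=; lia.
Qed.

(** Comparing blocks of equal letters: the second row has no 0, its letters 1
    lie below letters 0, and its letters 2 below letters 0 or 1. *)
Lemma columns_letters i j m l0 l l2 : (l0 + l + l2 <= i + j + m)%N ->
  all (fun c : 'I_3 * 'I_3 => c.1 < c.2)%N (zip (letters i j m) (letters l0 l l2))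
  = [&& l0 == 0%N, (l <= i)%N & (l + l2 <= i + j)%N].
Proof.
move=> le_s; have le_size : (size (letters l0 l l2) <= size (letters i j m))%N.
  by rewrite !size_letters.
have s_zip : size (zip (letters i j m) (letters l0 l l2)) = (l0 + l + l2)%N.
  by rewrite size2_zip // size_letters.
have nth_z q : (q < l0 + l + l2)%N ->
    nth (0, 0) (zip (letters i j m) (letters l0 l l2)) q
    = (nth 0 (letters i j m) q, nth 0 (letters l0 l l2) q).
  by move=> lt_q; rewrite nth_zip_cond s_zip lt_q.
apply/(all_nthP (0, 0))/and3P => [h|[/eqP l00 le_l le_B] q]; last first.
  rewrite s_zip => lt_q; rewrite nth_z //= !nth_letters ?(leq_trans lt_q le_s) //.
  by move: lt_q; rewrite l00 !add0n ltn0; do 3?case: ifP; lia.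
rewrite s_zip in h.
have hq q : (q < l0 + l + l2)%N ->
    ((if q < i then 0 else if q < i + j then 1 else 2)
     < (if q < l0 then 0 else if q < l0 + l then 1 else 2))%N.
  move=> lt_q; have := h q lt_q; rewrite nth_z //= !nth_letters //.
  exact: leq_trans lt_q le_s.
have l00 : l0 = 0%N.
  by case: (posnP l0) => // l0_gt0; have := hq 0%N; rewrite l0_gt0 ltn0 => /(_ _); lia.
subst l0; split=> //; rewrite leqNgt; apply/negP=> lt.
  have lt_i : (i < 0 + l + l2)%N by lia.
  by have := hq i lt_i; rewrite ltnn ltn0 add0n lt; case: ifP.
have lt_ij : (i + j < 0 + l + l2)%N by lia.
have := hq _ lt_ij; rewrite ltnn ltn0 [(i + j < i)%N]ltnNge leq_addr /=.
by case: ifP.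
Qed.

Lemma big_letters (R : comNzRingType) (F : 'I_3 -> R) n0 n1 n2 :
  \prod_(x <- letters n0 n1 n2) F x = F 0 ^+ n0 * F 1 ^+ n1 * F 2 ^+ n2.
Proof. by rewrite !big_cat /= !big_nseq !iter_mulr_1 mulrA. Qed.

Lemma big_letters_rows (R : comNzRingType) (F : 'I_3 -> R) n0 n1 n2 m1 m2 :
  (\prod_(x <- letters n0 n1 n2) F x) * (\prod_(x <- letters 0 m1 m2) F x)
    = F 0 ^+ n0 * F 1 ^+ (n1 + m1) * F 2 ^+ (n2 + m2).
Proof. by rewrite !big_letters expr0 mul1r !exprD; ring. Qed.

(** Gelfand-Tsetlin patterns with top row (a, b, 0): t.1.1 and t.1.2 count the
    letters 0 and 1 of the first row of a tableau, t.2 the letters 1 of the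
    second row. *)
Definition gt_pattern {a b} (t : 'I_a.+1 * 'I_a.+1 * 'I_b.+1) : bool :=
  [&& (t.1.1 + t.1.2 <= a)%N, (t.2 <= t.1.1)%N & (b <= t.1.1 + t.1.2)%N].

(** A semistandard tableau is determined by the three counts, since its rows
    are sorted. *)
Lemma schur_poly_gt_pattern a b : (b <= a)%N ->
  to_torus (schur_poly a b) = \sum_(t : 'I_a.+1 * 'I_a.+1 * 'I_b.+1 | gt_pattern t)
    tvar 0 ^+ t.1.1 * tvar 1 ^+ (t.1.2 + t.2)
      * tvar 2 ^+ (a - (t.1.1 + t.1.2) + (b - t.2)).
Proof.
move=> le_ba; rewrite /schur_poly rmorph_sum /=.
have prodE (s : seq 'I_3) : to_torus (\prod_(i <- s) 'X_i) = \prod_(i <- s) tvar i.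
  exact: rmorph_prod.
have cnt n (s : n.-tuple 'I_3) x : (count_mem x s < n.+1)%N.
  by rewrite ltnS -{2}(size_tuple s) count_size.
pose cnts (T : a.-tuple 'I_3 * b.-tuple 'I_3) :=
  (Ordinal (cnt _ T.1 0), Ordinal (cnt _ T.1 1), Ordinal (cnt _ T.2 1)).
have ssytE (T : a.-tuple 'I_3 * b.-tuple 'I_3) : is_ssyt T ->
  [/\ gt_pattern (cnts T),
      T.1 = letters (cnts T).1.1 (cnts T).1.2
              (a - ((cnts T).1.1 + (cnts T).1.2)) :> seq _
    & T.2 = letters 0 (cnts T).2 (b - (cnts T).2) :> seq _].
  case/and3P=> /sorted_letters_eq T1E /sorted_letters_eq T2E cols.
  have s1 := count_sum3 T.1; have s2 := count_sum3 T.2.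
  rewrite size_tuple in s1; rewrite size_tuple in s2.
  move: cols; rewrite T1E T2E columns_letters ?s1 ?s2 // => /and3P[/eqP c0 le1 le2].
  have -> : (a - ((cnts T).1.1 + (cnts T).1.2))%N = count_mem (2 : 'I_3) T.1.
    by move: s1 => /=; clear; lia.
  have -> : (b - (cnts T).2)%N = count_mem (2 : 'I_3) T.2.
    by move: s2 c0 => /=; clear; lia.
  split=> //; last by rewrite c0.
  apply/and3P; split=> //=.
    exact: leq_trans (leq_addr _ _) (eq_leq s1).
  by rewrite c0 add0n in s2; apply: leq_trans (eq_leq (esym s2)) le2.
rewrite (partition_big cnts (@gt_pattern a b)) => [|T /ssytE[]//].
apply: eq_bigr => t gt; case/and3P: (gt) => le1 le2 le3'.
have le4 : (t.2 <= b)%N by rewrite -ltnS.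
have s1 : size (letters t.1.1 t.1.2 (a - (t.1.1 + t.1.2))) == a.
  by rewrite size_letters subnKC.
have s2 : size (letters 0 t.2 (b - t.2)) == b by rewrite size_letters subnKC.
rewrite (big_pred1 (Tuple s1, Tuple s2)) => [|T]; last first.
  apply/andP/eqP => [[/ssytE[_ T1E T2E] /eqP cT]|->].
    rewrite cT in T1E T2E; case: T {cT} T1E T2E => T1 T2 /= T1E T2E.
    by congr (_, _); apply: val_inj.
  have [c0 c1 _] := count_letters t.1.1 t.1.2 (a - (t.1.1 + t.1.2)).
  have [_ c1' _] := count_letters 0 t.2 (b - t.2).
  split.
    rewrite /is_ssyt !sorted_letters columns_letters /=; first by rewrite le2 subnKC.
    by rewrite add0n !subnKC.
  have tE : t = (t.1.1, t.1.2, t.2) by case: (t) => [[]].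
  by apply/eqP; rewrite [RHS]tE; congr (_, _, _); apply: val_inj.
by rewrite rmorphM /= !prodE big_letters_rows.
Qed.

End Schur.

(** * Weight multiplicities of two-row shapes *)

Section Multiplicity.

Local Open Scope nat_scope.

Lemma sum_interval n lo hi :
  \sum_(l < n) (lo <= l < hi : nat) = minn hi n - lo.
Proof.
elim: n => [|n IHn]; first by rewrite big_ord0 minn0.
by rewrite big_ord_recr /= IHn; case: (leqP lo n); case: (leqP hi n) => /=; lia.
Qed.

(** Fixing the weight fixes t.1.1 and the sum t.1.2 + t.2, so t.2 is the only
    free entry; it ranges over an interval. *)
Lemma gt_pattern_count a b u w : b <= a ->
  \sum_(t : 'I_a.+1 * 'I_a.+1 * 'I_b.+1 | gt_pattern t)
     ((t.1.1 == u :> nat) && (t.1.2 + t.2 == w) : nat) =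
  (if b <= u + w then b.+1 - (b - u) - (b - w) - (u + w - a) else 0).
Proof.
move=> le_ba; pose cond l := [&& l <= u, l <= w, u + w - l <= a & b <= u + w - l].
transitivity (\sum_(l < b.+1) (cond l : nat)).
  rewrite (partition_big (fun t => t.2) xpredT) //=; apply: eq_bigr => l _.
  have [/and4P[lu lw le_a le_b]|ncond] := boolP (cond l); last first.
    apply: big1 => t /andP[/and3P[h1 h2 h3] /eqP t2].
    have [/andP[/eqP t1 /eqP t12]|//] := boolP (_ && _); case/negP: ncond.
    by rewrite /cond -t1 -t12 -t2; apply/and4P; split; lia.
  have lt_u : u < a.+1 by lia.
  have lt_w : w - l < a.+1 by lia.
  rewrite (@sum_nat_only _ _ _ _ (Ordinal lt_u, Ordinal lt_w, l)) /=.
  - by rewrite eqxx subnK ?eqxx.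
  - exact: index_enum_uniq.
  - exact: mem_index_enum.
  - by rewrite eqxx andbT; apply/and3P; split=> /=; lia.
  case=> [[t11 t12] t2] /andP[_ /eqP/= ->]; rewrite lt0b => /andP[/eqP e1 /eqP e2].
  by congr (_, _, _); apply: val_inj => //=; rewrite -e2 addnK.
case: leqP => [le_b|lt_b]; last first.
  by apply: big1 => l _; apply/eqP; rewrite eqb0 /cond; apply/negP => /and4P[]; lia.
under eq_bigr => l _.
  have -> : cond l = (u + w - a <= l < b.+1 - (b - u) - (b - w)).
    by have := ltn_ord l; rewrite ltnS /cond => le_lb; lia.
  over.
by rewrite sum_interval; congr (_ - _); lia.
Qed.

End Multiplicity.

(** * Comparison with Schur polynomials *)

Section Characters.

Local Notation x_ := tvar.
Local Notation y_ := tvar_inv.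

Lemma iter_char_frob_sum p j (I : Type) (r : seq I) (P : pred I) (F : I -> torus_ring) :
  iter j (char_frob p) (\sum_(i <- r | P i) F i)
  = \sum_(i <- r | P i) iter j (char_frob p) (F i).
Proof. by elim: j => //= j ->; rewrite rmorph_sum. Qed.

Lemma iter_char_frob_monomial p j a1 a2 a3 :
  iter j (char_frob p) (x_ 0 ^+ a1 * x_ 1 ^+ a2 * x_ 2 ^+ a3)
  = x_ 0 ^+ (p ^ j * a1) * x_ 1 ^+ (p ^ j * a2) * x_ 2 ^+ (p ^ j * a3).
Proof.
elim: j => [|j /= ->]; first by rewrite expn0 !mul1n.
by rewrite !rmorphM !rmorphXn /= !char_frob_tvar -!exprM !mulnA -!expnS.
Qed.

(** In SL_3 the product of the three variables is 1, so that all exponents may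
    be shifted by the same s; this avoids negative exponents. *)
Lemma monomial_shift_ring (R : comNzRingType) (x y : 'I_3 -> R) u0 u1 u2 s r0 r1 r2 :
  (forall i, x i * y i = 1) -> x 0 * x 1 * x 2 = 1 ->
  (r0 <= s)%N -> (r1 <= s)%N -> (r2 <= s)%N ->
  x 0 ^+ (u0 + s - r0) * x 1 ^+ (u1 + s - r1) * x 2 ^+ (u2 + s - r2)
  = y 0 ^+ r0 * y 1 ^+ r1 * y 2 ^+ r2 * (x 0 ^+ u0 * x 1 ^+ u1 * x 2 ^+ u2).
Proof.
move=> xy x1 le0 le1 le2.
have sh i u r : (r <= s)%N -> x i ^+ (u + s - r) = y i ^+ r * x i ^+ u * x i ^+ s.
  move=> le_rs; rewrite -addnBA // exprD -[in RHS](subnK le_rs) exprD.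
  have e : x i ^+ r * y i ^+ r = 1 by rewrite -exprMn xy expr1n.
  by rewrite -[LHS]mulr1 -e; ring.
have xs : x 0 ^+ s * x 1 ^+ s * x 2 ^+ s = 1 by rewrite -!exprMn x1 expr1n.
rewrite !sh // -[RHS]mulr1 -xs; ring.
Qed.

Lemma monomial_shift u0 u1 u2 s r0 r1 r2 :
  (r0 <= s)%N -> (r1 <= s)%N -> (r2 <= s)%N ->
  x_ 0 ^+ (u0 + s - r0) * x_ 1 ^+ (u1 + s - r1) * x_ 2 ^+ (u2 + s - r2)
  = y_ 0 ^+ r0 * y_ 1 ^+ r1 * y_ 2 ^+ r2 * (x_ 0 ^+ u0 * x_ 1 ^+ u1 * x_ 2 ^+ u2).
Proof.
apply: (@monomial_shift_ring torus_ring tvar tvar_inv) => [i|]; first exact: tvarK.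
rewrite -prod_tvar !big_ord_recl big_ord0 mulr1 mulrA.
by congr (_ * _ * _); congr x_; apply: val_inj.
Qed.

(** Both sides are 1 + min (a - b, b, a - u, a - w, u, w, u + w - b, a + b - u
    - w), cut off at 0. *)
Lemma kostka_interval a b u w : (b <= a)%N ->
  (a.+1 - (b + (u - b) + (w - b) + (a - (u + w))) =
   if b <= u + w then b.+1 - (b - u) - (b - w) - (u + w - a) else 0)%N.
Proof.
move=> le_ba; case: (leqP b (u + w)) => h; case: (leqP u b) => h1;
  case: (leqP w b) => h2; case: (leqP a (u + w)) => h3; lia.
Qed.

(** The two-row shape (a, b, 0), shifted by s, has highest weight (n, q m - 1,
    s); its weights translated by - q (a_1, a_2, a_3) are the exponents t with
    nonzero cone_dim. *)
Lemma cone_dim_kostka d n q a1 a2 a3 t1 t2 t3 :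
  (n <= d)%N -> (0 < q)%N -> (n.+1 %/ q = (a1 + a2 + a3).+1)%N ->
  (t1 + t2 + t3 = d.+1 + n)%N ->
  (d.+1 + 2 <= q + q * (n.+1 %/ q))%N ->
  let a := (q + n.+1 - (d.+1 + 2))%N in
  let b := (q + q * (n.+1 %/ q) - (d.+1 + 2))%N in
  let s := (d.+2 - q)%N in
  cone_dim n.+1 t1.+1 t2.+1 t3.+1 q a1 a2 a3 =
  \sum_(t : 'I_a.+1 * 'I_a.+1 * 'I_b.+1 | gt_pattern t)
     ((t.1.1 + s == t1 + q * a1)%N && (t.1.2 + t.2 + s == t2 + q * a2)%N : nat).
Proof.
move=> le_nd q_gt0 mE tE le_b a b s.
have le_qm := leq_trunc_div n.+1 q; rewrite mulnC in le_qm.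
have le_ba : (b <= a)%N by rewrite /a /b leq_sub2r // leq_add2l.
have qmE : (q * (n.+1 %/ q) = q * a1 + q * a2 + q * a3 + q)%N.
  by rewrite mE mulnSr !mulnDr.
have [le_su|lt_us] := leqP s (t1 + q * a1); last first.
  rewrite big1 => [|t _]; last first.
    by case: eqP => // e; move: lt_us; rewrite -e; clear; lia.
  apply/eqP; rewrite cone_dimE subn_eq0.
  have := leq_add_subn t2.+1 (q * a1 + q * a3 + q).
  have := leq_add_subn t3.+1 (q * a1 + q * a2 + q).
  move: le_nd tE le_qm lt_us; rewrite /s qmE; clear; do 3 move: (_ - (_ + _))%N => ?.
  by lia.
have [le_sw|lt_ws] := leqP s (t2 + q * a2); last first.
  rewrite big1 => [|t _]; last first.
    by case: eqP => // _; case: eqP => // e; move: lt_ws; rewrite -e; clear; lia.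
  apply/eqP; rewrite cone_dimE subn_eq0.
  have := leq_add_subn t1.+1 (q * a2 + q * a3 + q).
  have := leq_add_subn t3.+1 (q * a1 + q * a2 + q).
  move: le_nd tE le_qm lt_ws; rewrite /s qmE; clear; do 3 move: (_ - (_ + _))%N => ?.
  by lia.
transitivity (\sum_(t : 'I_a.+1 * 'I_a.+1 * 'I_b.+1 | gt_pattern t)
   ((t.1.1 == (t1 + q * a1 - s)%N :> nat)
      && (t.1.2 + t.2 == t2 + q * a2 - s)%N : nat)%N);
  last first.
  apply: eq_bigr => t _; congr (nat_of_bool (_ && _)).
    by rewrite -(eqn_add2r s) subnK.
  by rewrite -(eqn_add2r s) subnK.
rewrite gt_pattern_count // -kostka_interval // cone_dimE.
move: le_nd tE le_qm le_b le_su le_sw; rewrite /a /b /s qmE {a b s le_ba mE qmE}.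
move: (q * a1)%N (q * a2)%N (q * a3)%N => Q1 Q2 Q3 *.
have -> : (t1.+1 - (Q2 + Q3 + q) = t1 + Q1 - (d.+2 - q)
            - (q + (Q1 + Q2 + Q3 + q) - (d.+1 + 2)))%N by lia.
have -> : (t2.+1 - (Q1 + Q3 + q) = t2 + Q2 - (d.+2 - q)
            - (q + (Q1 + Q2 + Q3 + q) - (d.+1 + 2)))%N by lia.
have -> : (t3.+1 - (Q1 + Q2 + q) = q + n.+1 - (d.+1 + 2)
            - (t1 + Q1 - (d.+2 - q) + (t2 + Q2 - (d.+2 - q))))%N by lia.
lia.
Qed.

End Characters.

(** * The character of the kernel *)

Section Assembly.

Local Notation x_ := tvar.
Local Notation y_ := tvar_inv.

Lemma tvar_prod_weight m (al : mons m) :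
  \prod_(i < 3) tvar i ^+ mons_val al i
  = x_ 0 ^+ mons_val al 0 * x_ 1 ^+ mons_val al 1 * x_ 2 ^+ mons_val al 2.
Proof.
rewrite !big_ord_recl big_ord0 mulr1 mulrA.
by congr (_ * _ * _); congr (tvar _ ^+ mons_val al _); apply: val_inj.
Qed.

(** When q (m + 1) is too small for the shape to be a partition, every cone_dim
    vanishes as well.  Otherwise each tableau contributes exactly one weight
    al: its exponents are nonnegative because q a_i <= s, and they have the
    degree of al. *)
Lemma cone_character d n q a1 a2 a3 :
  (n <= d)%N -> (0 < q)%N -> (n.+1 %/ q = (a1 + a2 + a3).+1)%N ->
  \sum_(al : mons (d.+1 + n))
     (cone_dim n.+1 (mons_val al 0).+1 (mons_val al 1).+1 (mons_val al 2).+1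
        q a1 a2 a3)%:R * \prod_(i < 3) tvar i ^+ mons_val al i
  = y_ 0 ^+ (q * a1) * y_ 1 ^+ (q * a2) * y_ 2 ^+ (q * a3)
    * schur ((q + n.+1)%:Z - (d.+1 + 2)%:Z)
            ((q + q * (n.+1 %/ q))%:Z - (d.+1 + 2)%:Z).
Proof.
move=> le_nd q_gt0 mE.
have le_qm := leq_trunc_div n.+1 q; rewrite mulnC in le_qm.
have qmE : (q * (n.+1 %/ q) = q * a1 + q * a2 + q * a3 + q)%N.
  by rewrite mE mulnSr !mulnDr.
have [le_b|lt_b] := leqP (d.+1 + 2) (q + q * (n.+1 %/ q)); last first.
  rewrite /schur ifF ?mulr0; last by move: lt_b; clear; lia.
  rewrite big1 // => al _; rewrite (_ : cone_dim _ _ _ _ _ _ _ _ = 0%N) ?mul0r //.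
  apply/eqP; rewrite cone_dimE subn_eq0.
  have := leq_add_subn (mons_val al 0).+1 (q * a2 + q * a3 + q).
  have := leq_add_subn (mons_val al 1).+1 (q * a1 + q * a3 + q).
  have := leq_add_subn (mons_val al 2).+1 (q * a1 + q * a2 + q).
  have := mons_sum3 al; move: lt_b le_nd le_qm; rewrite qmE; clear.
  move: (mons_val al 0) (mons_val al 1) (mons_val al 2) => t1 t2 t3.
  by do 3 move: (_ - (_ + _))%N => ?; lia.
set a := (q + n.+1 - (d.+1 + 2))%N; set b := (q + q * (n.+1 %/ q) - (d.+1 + 2))%N.
pose s := (d.+2 - q)%N.
have le_ba : (b <= a)%N by rewrite /a /b leq_sub2r // leq_add2l.
have -> : (q + n.+1)%:Z - (d.+1 + 2)%:Z = a%:Z.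
  by rewrite /a subzn // (leq_trans le_b) // leq_add2l.
have -> : (q + q * (n.+1 %/ q))%:Z - (d.+1 + 2)%:Z = b%:Z by rewrite /b subzn.
have aE : (a + (d.+1 + 2) = q + n.+1)%N.
  by rewrite /a subnK // (leq_trans le_b) // leq_add2l.
have bE : (b + (d.+1 + 2) = q + (q * a1 + q * a2 + q * a3 + q))%N.
  by rewrite /b -qmE subnK.
have sE : (s + q = d.+2)%N.
  by rewrite /s subnK //; move: le_nd le_qm; rewrite qmE; clear; lia.
rewrite /schur !lez_nat le_ba /= schur_poly_gt_pattern // mulr_sumr.
under eq_bigr => al _.
  rewrite (cone_dim_kostka le_nd q_gt0 mE (mons_sum3 al) le_b) natr_sum mulr_suml; over.
rewrite exchange_big /=; apply: eq_bigr => t /and3P[gt1 gt2 gt3].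
have [r1 r2 r3] : [/\ q * a1 <= s, q * a2 <= s & q * a3 <= s]%N.
  by move: le_nd le_qm q_gt0; rewrite /s qmE; clear; split; lia.
have t2_le : (t.2 <= b)%N by rewrite -ltnS.
have [al [al0 al1 al2]] : exists al : mons (d.+1 + n),
    [/\ mons_val al 0 = (t.1.1 + s - q * a1)%N,
        mons_val al 1 = (t.1.2 + t.2 + s - q * a2)%N
      & mons_val al 2 = (a - (t.1.1 + t.1.2) + (b - t.2) + s - q * a3)%N].
  apply: mons3_exists.
  move: gt1 gt2 gt3 t2_le r1 r2 r3 aE bE sE; clear.
  by move: (nat_of_ord t.1.1) (nat_of_ord t.1.2) (nat_of_ord t.2); lia.
rewrite (bigD1 al) //= [X in _ + X]big1 ?addr0 => [|be ne].
  rewrite tvar_prod_weight al0 al1 al2 monomial_shift //.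
  rewrite !subnK ?eqxx ?mul1r //; first exact: leq_trans r2 (leq_addl _ _).
  exact: leq_trans r1 (leq_addl _ _).
case: eqP => e0; rewrite ?mul0r //; case: eqP => e1; rewrite ?mul0r //.
case/eqP: ne; apply: mons_val_inj; apply/mnmP.
have be0 : mons_val be 0 = mons_val al 0 by rewrite al0 e0 addnK.
have be1 : mons_val be 1 = mons_val al 1 by rewrite al1 e1 addnK.
have := etrans (mons_sum3 be) (esym (mons_sum3 al)).
by rewrite be0 be1 => /addnI be2; apply: ord3_ind.
Qed.

End Assembly.

Theorem theorem3p7 (p : nat) (k : fieldType) (d e : nat)
    (p_prime : prime p) (char_k : p \in [pchar k])
    (e_gt0 : (0 < e)%N) (le_ed : (e <= d)%N) :
  kappa k d e =
    \sum_(1 <= i < (trunc_log p e).+1)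
       char_dual (iter i (char_frob p) (even_carry_poly p (e %/ p ^ i)))
       * schur ((p ^ i + e)%:Z - (d + 2)%:Z)
               ((p ^ i + p ^ i * (e %/ p ^ i))%:Z - (d + 2)%:Z).
Proof.
case: e e_gt0 le_ed => // n _; case: d => // d le_nd.
rewrite /kappa /char_of /K_space /=.
under eq_bigr => al _.
  rewrite (dim_ker_weight_space char_k al le_nd) /even_carry_count.
  rewrite natr_sum mulr_suml; over.
rewrite exchange_big /=; apply: eq_bigr => i _.
have q_gt0 : (0 < p ^ i)%N by rewrite expn_gt0 prime_gt0.
under eq_bigr => al _ do rewrite natr_sum mulr_suml.
rewrite exchange_big /= /even_carry_poly iter_char_frob_sum rmorph_sum mulr_suml.
apply: eq_bigr => a1 _.
under eq_bigr => al _ do rewrite natr_sum mulr_suml.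
rewrite exchange_big /= iter_char_frob_sum rmorph_sum mulr_suml.
apply: eq_bigr => a2 _.
under eq_bigr => al _ do rewrite natr_sum mulr_suml.
rewrite exchange_big /= iter_char_frob_sum rmorph_sum mulr_suml.
apply: eq_bigr => a3 /andP[/eqP mE _].
rewrite cone_character //; last by move: mE; rewrite addn1.
by rewrite iter_char_frob_monomial !rmorphM !rmorphXn /= !char_dual_tvar.
Qed.
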